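(* Let $V=\bigcup_{0<\alpha<1}V_\alpha$, where $V_\alpha$ is the class of rank-one cutting-and-stacking transformations $T_v$ with $v=(n+1,\lfloor n^{\alpha}\rfloor h_n,m_n)_{n\ge 0}$ and $\lim_{n\to\infty}\lfloor n^{\alpha}\rfloor/m_n=0$ (the construction of $T_v$ is given in the context). Then each transformation $T\in V$ is a weakly rationally ergodic infinite measure preserving transformation.
   Context: **Weak rational ergodicity.** Transformations are invertible and measure preserving on $\sigma$-finite, nonatomic Lebesgue measure spaces $(X,\mu)$; ''infinite measure preserving'' means $\mu(X)=\infty$. $T$ is weakly rationally ergodic if it is conservative ergodic and there exists a set $F$ of positive finite measure such that, with $a_n(F)=\sum_{k=0}^{n-1}\mu(F\cap T^kF)/\mu(F)^2$, one has $\lim_{n\to\infty}\frac{1}{a_n(F)}\sum_{k=0}^{n-1}\mu(A\cap T^kB)=\mu(A)\mu(B)$ for all measurable $A,B\subset F$. **Construction of $T_v$.** Let $v=(k_n,\ell_n,m_n)_{n\ge0}$ with $k_n,m_n\geq 1$ and $\ell_n\ge 0$ integers. A column is an ordered finite stack of pairwise disjoint intervals (levels) of equal length; its height is the number of levels, and the associated map sends each level except the top one to the level directly above by translation. A column is cut into $r$ subcolumns of equal width by cutting every level into $r$ subintervals of equal length; the subcolumns are ordered left to right. Stacking columns of equal width from left to right means putting the second on top of the first, and so on. Spacers are new intervals, disjoint from everything used so far, of the appropriate length. Start with $C_0=I_0$, an interval of positive finite length (normalized so that $\mu(I_0)=1$, where $\mu$ is Lebesgue measure), of height $h_0=1$.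 Given the column $C_n$ of height $h_n$: (1) Cut $C_n$ into $k_n$ subcolumns $C_n(0),\dots,C_n(k_n-1)$ of equal width. (2) Put $\ell_n$ spacers on top of each $C_n(i)$, $0\le i<k_n-1$, and stack these $k_n-1$ subcolumns left to right into one subcolumn of height $(h_n+\ell_n)(k_n-1)$ (empty if $k_n=1$). (3) Cut this subcolumn into $m_n$ subcolumns of equal width and stack them left to right. Separately cut the last subcolumn $C_n(k_n-1)$ (no spacers added) into $m_n$ subcolumns of equal width and stack them left to right. (4) Stack the second resulting column, of height $m_nh_n$, on top of the first, of height $m_n(h_n+\ell_n)(k_n-1)$. Finally put $m_n(h_n+\ell_n)(k_n-1)+m_nh_n$ spacers on top. The result is $C_{n+1}$, of height $h_{n+1}=2m_n(h_n+\ell_n)(k_n-1)+2m_nh_n$. The maps associated to the columns $C_n$ extend one another and define (mod null sets) an invertible measure preserving transformation $T_v$ of $X=\bigcup_n C_n$ with Lebesgue measure $\mu$. **The classes.** For $0<\alpha<1$, $V_\alpha$ is the set of all $T_v$ with $k_n=n+1$, $\ell_n=\lfloor n^\alpha\rfloor h_n$, and $(m_n)$ any sequence of positive integers with $\lim_{n\to\infty}\lfloor n^\alpha\rfloor/m_n=0$. *)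

(* Defs.v *)
From HB Require Import structures.
From mathcomp Require Import all_boot all_order all_algebra.
From mathcomp Require Import all_classical all_reals all_analysis.

Set Implicit Arguments.
Unset Strict Implicit.
Unset Printing Implicit Defensive.

Import Order.TTheory GRing.Theory Num.Theory.
Import numFieldNormedType.Exports.

Local Open Scope classical_set_scope.
Local Open Scope ring_scope.

(* The system under study is the subset X of the ambient measure space (Y, mu)
   with the induced measure; T is only relevant through its values on X. *)
Section ergodic_theory.
Context {d : measure_display} {Y : measurableType d} {R : realType}.
Variables (mu : {measure set Y -> \bar R}) (X : set Y) (T : Y -> Y).

(* Invertibility is meant modulo null sets: T restricts to a bimeasurable,
   measure preserving bijection of a subset X0 of full measure. *)
Definition invertible_measure_preserving : Prop :=
  [/\ measurable X,
      measurable_fun X T &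
      exists X0 : set Y,
        [/\ measurable X0, X0 `<=` X, mu (X `\` X0) = 0%E & set_bij X0 X0 T] /\
        forall A, measurable A -> A `<=` X0 ->
          measurable (T @` A) /\ mu (X0 `&` T @^-1` A) = mu A].

Definition infinite_measure_preserving : Prop :=
  invertible_measure_preserving /\ mu X = +oo%E.

Definition wandering (W : set Y) : Prop :=
  trivIset setT (fun n : nat => X `&` iter n T @^-1` W).

Definition conservative : Prop :=
  forall W, measurable W -> W `<=` X -> wandering W -> mu W = 0%E.

Definition ergodic : Prop :=
  forall A, measurable A -> A `<=` X ->
    mu (A `\` T @^-1` A) = 0%E -> mu ((X `&` T @^-1` A) `\` A) = 0%E ->
    mu A = 0%E \/ mu (X `\` A) = 0%E.

(* [fine] is harmless below: it is only used on subsets of a set F of finite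
   measure. *)
Definition overlap_sum (A B : set Y) (n : nat) : R :=
  \sum_(0 <= k < n) fine (mu (A `&` iter k T @` B)).

Definition return_sequence (F : set Y) (n : nat) : R :=
  overlap_sum F F n / fine (mu F) ^+ 2.

Definition weakly_rationally_ergodic : Prop :=
  [/\ invertible_measure_preserving, conservative, ergodic &
      exists F : set Y,
        [/\ measurable F, F `<=` X, (0 < mu F)%E, (mu F < +oo)%E &
            forall A B, measurable A -> measurable B -> A `<=` F -> B `<=` F ->
              (return_sequence F n)^-1 * overlap_sum A B n @[n --> \oo]
                --> fine (mu A) * fine (mu B)]].

End ergodic_theory.

Section cutting_and_stacking.
Context {R : realType}.

(* A column is given by the common length of its levels and the list of their
   left endpoints, from bottom to top.  Levels are half-open, so that cutting
   a level yields an exact partition of it. *)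
Record column := Column { width : R; endpoints : seq R }.

Definition height (C : column) : nat := size (endpoints C).

Definition left_end (C : column) (i : nat) : R := nth 0 (endpoints C) i.

Definition level (C : column) (i : nat) : set R :=
  [set x | left_end C i <= x < left_end C i + width C].

Definition support (C : column) : set R :=
  \bigcup_(i in [set i | (i < height C)%N]) level C i.

Definition disjoint_levels (C : column) : Prop :=
  trivIset [set i | (i < height C)%N] (level C).

(* T extends the map associated to C *)
Definition extends_column_map (C : column) (T : R -> R) : Prop :=
  forall i x, (i.+1 < height C)%N -> level C i x ->
    T x = x + (left_end C i.+1 - left_end C i).

(* the subcolumn number i, from the left and starting at 0, when C is cut into
   r subcolumns of equal width *)
Definition subcolumn (C : column) (r i : nat) : column :=
  Column (width C / r%:R) [seq a + i%:R * (width C / r%:R) | a <- endpoints C].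

(* the columns in s are assumed to have width w; the first one goes to the
   bottom *)
Definition stack (w : R) (s : seq column) : column :=
  Column w (flatten [seq endpoints C | C <- s]).

Definition cut_and_stack (C : column) (m : nat) : column :=
  stack (width C / m%:R) [seq subcolumn C m j | j <- iota 0 m].

Definition new_spacers (S : column) (used : set R) : Prop :=
  disjoint_levels S /\ support S `&` used = set0.

(* One step of the construction: S i lists the spacers put on top of the i-th
   subcolumn, U those put on top of everything at the end.  For k = 1 the
   column D is empty. *)
Definition next_column (k l m : nat) (C C' : column) : Prop :=
  exists (S : nat -> seq R) (U : seq R),
    let w := width C / k%:R in
    let spacers i := Column w (S i) in
    let D := stack w [seq stack w [:: subcolumn C k i; spacers i]
                     | i <- iota 0 k.-1] in
    let all_spacers := stack w [seq spacers i | i <- iota 0 k.-1] in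
    let top := Column (w / m%:R) U in
    [/\ forall i, (i < k.-1)%N -> size (S i) = l,
        new_spacers all_spacers (support C),
        size U = (m * (height C + l) * k.-1 + m * height C)%N,
        new_spacers top (support C `|` support all_spacers) &
        C' = stack (w / m%:R) [:: cut_and_stack D m;
                                  cut_and_stack (subcolumn C k k.-1) m;
                                  top]].

Definition initial_column (C : column) : Prop :=
  width C = 1 /\ height C = 1%N.

Definition column_sequence (k l m : nat -> nat) (C : nat -> column) : Prop :=
  initial_column (C 0%N) /\
  forall n, [/\ (0 < k n)%N, (0 < m n)%N &
                next_column (k n) (l n) (m n) (C n) (C n.+1)].

(* (X, T) is the transformation defined by the columns C.  Every point of X
   lies below the top level of some C n, because each C n.+1 has spacers on
   top, so T is determined on all of X. *)
Definition defined_by_columns (C : nat -> column) (X : set R) (T : R -> R) :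
    Prop :=
  X = \bigcup_n support (C n) /\ forall n, extends_column_map (C n) T.

Definition class_V_ (alpha : R) (X : set R) (T : R -> R) : Prop :=
  exists (k l m : nat -> nat) (C : nat -> column),
    [/\ column_sequence k l m C, defined_by_columns C X T,
        forall n, k n = n.+1,
        forall n, l n = (Num.truncn (n%:R `^ alpha) * height (C n))%N &
        (Num.truncn (n%:R `^ alpha))%:R / (m n)%:R @[n --> \oo] --> (0 : R)].

Definition class_V (X : set R) (T : R -> R) : Prop :=
  exists alpha : R, 0 < alpha < 1 /\ class_V_ alpha X T.

End cutting_and_stacking.

(* Main.v *)
From mathcomp Require Import all_boot all_order all_algebra.
From mathcomp Require Import all_classical all_reals all_analysis.
From mathcomp Require Import measurable_realfun.
From mathcomp Require Import zify ring lra.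
Require Import Defs.

(* Let F be the initial level, h_n the height of C_n, and, with & for
   intersection, a_r = sum_(j < r) mu(F & T^j F).  Later columns contain C_n
   only through whole copies, so if A is a union of levels of C_n inside F, then
   the sums of 1_A - mu(A) 1_F along orbit segments are bounded, whence
     sum_(j < r) mu(A & T^j B) = mu(A) sum_(j < r) mu(F & T^j B) + O(1),
   and symmetrically in B.  Since a_r tends to infinity, the limit for arbitrary
   A and B follows by approximation, provided that
     sum_(j < r) mu(F & T^j E) <= (16 mu(E) + o(1)) a_r
   uniformly in E, and similarly for mu(E & T^j F).  For h_n <= 2 r <= h_(n+1)
   this is seen inside C_(n+1): the pairs of copies of C_n in its sparse part
   (spacing h_n + l_n) contribute from each point at most a constant times a_r;
   only a proportion 1 / (n+1) of the copies lies in the dense part (spacing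
   h_n), which is denser by a factor of about n^alpha, so all pairs meeting it
   contribute O(n^alpha / n) a_r in total.

   Conservativity and ergodicity follow from the same limit: for A = B
   wandering, or for A the trace on F of an invariant set and B = F \ A, the sums
   sum_(j < r) mu(A & T^j B) are bounded although a_r is not. *)

Set Implicit Arguments.
Unset Strict Implicit.
Unset Printing Implicit Defensive.

Import Order.TTheory GRing.Theory Num.Theory.
Import numFieldNormedType.Exports.

Local Open Scope classical_set_scope.
Local Open Scope ring_scope.

(** * Counting pairs of positions at bounded distance *)

(** The bounded-deviation argument alone does not reach arbitrary sets: its O(1) depends on the
    column that describes the set, hence on the precision of the approximation. This is why a
    separate upper bound, linear in mu(E) with a constant independent of E, is needed. The range h_n
    <= 2 r <= h_(n+1) comes from the final spacers. They fill the upper half of C_(n+1), so F lies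
    in the lower half, and T^j with j < r carries each level of the lower half to a level of the
    same column. Overlaps thus become sums over pairs of positions in a single list of level values.
    The constant 16 is 2 * 4 * 2. A window of length r holds the mass of at most 2 t sparse copies;
    the lower bound for a_r loses 2 by keeping only ordered pairs and 2 by cutting the sparse part
    into whole blocks of t copies; and n + 1 <= 2 n compares the whole of F with its sparse part. *)

Section window_sums.
Context {R : realFieldType}.
Implicit Types (f g e : nat -> R) (H r X : nat).

Definition wsum f a b : R := \sum_(a <= y < b) f y.

Lemma wsum_cat f a b c : (a <= b <= c)%N -> wsum f a c = wsum f a b + wsum f b
  c.
Proof. by move=> /andP[ab bc]; rewrite /wsum (big_cat_nat ab bc). Qed.

Lemma wsumD f g a b :
  wsum (fun x => f x + g x) a b = wsum f a b + wsum g a b.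
Proof. exact: big_split. Qed.

Lemma wsum_ge0 f a b : (forall x, 0 <= f x) -> 0 <= wsum f a b.
Proof. by move=> f0; apply: sumr_ge0. Qed.

Lemma ler_wsum f g a b :
  (forall x, (x < b)%N -> f x <= g x) -> wsum f a b <= wsum g a b.
Proof.
move=> fg; rewrite /wsum big_nat_cond [leRHS]big_nat_cond.
by apply: ler_sum => i /andP[/andP[_ ib] _]; exact: fg.
Qed.

Lemma wsum_le_widen f a b a' b' : (forall x, 0 <= f x) ->
  (a' <= a)%N -> (b <= b')%N -> wsum f a b <= wsum f a' b'.
Proof.
move=> f0 aa bb; have [ba|ab] := leqP b a.
  by rewrite /wsum big_geq//; apply: wsum_ge0.
rewrite (@wsum_cat f a' a b'); last by lia.
rewrite (@wsum_cat f a b b'); last by lia.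
by rewrite addrCA lerDl addr_ge0// wsum_ge0.
Qed.

Lemma wsum_widenr f a b b' : (forall x, (b <= x)%N -> f x = 0) -> (b <= b')%N ->
  wsum f a b' = wsum f a b.
Proof.
move=> f0 bb; have [ab|ba] := leqP a b.
  rewrite (@wsum_cat _ a b b') ?ab// [X in _ + X](_ : _ = 0) ?addr0//.
  by rewrite /wsum big_nat big1// => i /andP[bi _]; exact: f0.
rewrite /wsum (big_geq (ltnW ba)) big_nat big1// => i /andP[ai _].
by apply: f0; lia.
Qed.

(** An interval of length at most r is covered by r %/ X + 1 consecutive windows of length X. *)
Lemma wsum_le_quot f X q a b r : (0 < X)%N -> (forall x, 0 <= f x) ->
  (forall x, wsum f x (x + X) <= q) -> (b <= a + r)%N ->
  wsum f a b <= (r %/ X).+1%:R * q.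
Proof.
move=> X0 f0 fq br.
apply: (@le_trans _ _ (wsum f a (a + (r %/ X).+1 * X))).
  apply: wsum_le_widen => //; apply: (leq_trans br); rewrite leq_add2l.
  by rewrite ltnW// ltn_ceil.
elim: (r %/ X).+1 => [|j IH];
  first by rewrite mul0n addn0 /wsum big_geq// mul0r.
rewrite (@wsum_cat _ a (a + j * X)); last by lia.
rewrite -natr1 mulrDl mul1r lerD// mulSn (addnC X) addnA; exact: fq.
Qed.

Lemma normr_wsum_le f K a b : (forall x, `|wsum f 0 x| <= K) ->
  (a <= b)%N -> `|wsum f a b| <= K *+ 2.
Proof.
move=> fK ab; have -> : wsum f a b = wsum f 0 b - wsum f 0 a.
  by rewrite (@wsum_cat f 0 a b)// addrAC subrr add0r.
by rewrite mulr2n (le_trans (ler_normB _ _))// lerD.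
Qed.

(** The square is a sum over all pairs of positions; by symmetry the pairs x <= y, diagonal
    included, carry at least half of it. *)
Lemma wsum_half_square f n : (forall x, 0 <= f x) ->
  (wsum f 0 n) ^+ 2 <= wsum (fun x => f x * wsum f x n) 0 n *+ 2.
Proof.
move=> f0; elim: n => [|n IH]; first by rewrite /wsum !big_geq// expr0n mul0rn.
have E : wsum (fun x => f x * wsum f x n.+1) 0 n.+1 =
    wsum (fun x => f x * wsum f x n) 0 n + wsum f 0 n * f n + f n * f n.
  rewrite {1}/wsum big_nat_recr//= {2}/wsum big_nat1; congr (_ + _).
  rewrite /wsum mulr_suml -big_split/= big_nat [RHS]big_nat.
  apply: eq_bigr => i /andP[_ ilt].
  by rewrite (big_nat_recr n)/= ?mulrDr//; lia.
rewrite E {1}/wsum big_nat_recr//= -/(wsum f 0 n).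
have := sqr_ge0 (f n); move: IH.
set S := wsum _ _ _; set W := wsum f 0 n; nra.
Qed.

Lemma wsum_blocks f B Z :
  wsum f 0 (B * Z) = \sum_(0 <= b < B) wsum (fun i => f (b * Z + i)%N) 0 Z.
Proof.
elim: B => [|B IH]; first by rewrite mul0n /wsum !big_geq.
rewrite big_nat_recr//= -IH (@wsum_cat _ 0 (B * Z)) ?leq0n ?mulSn ?leq_addl//.
congr (_ + _); rewrite /wsum -{1}[(B * Z)%N]add0n big_addn addnK.
by apply: eq_bigr => i _; rewrite addnC.
Qed.

End window_sums.

Section pair_sums.
Context {R : realFieldType}.
Implicit Types (f g e : nat -> R) (H r X : nat).

(* With g and f the measures of two sets in the levels of a column, this counts
   the returns from the first set to the second within time r: T^j carries
   level d to level y exactly for j = y - d. *)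
Definition pair_sum H r g f : R :=
  \sum_(0 <= d < H) \sum_(0 <= y < H | (d <= y < d + r)%N) g d * f y.

Lemma sum_nat_interval f (P : pred nat) a b N : (b <= N)%N ->
  (forall x, P x = (a <= x < b)%N) ->
  \sum_(0 <= y < N | P y) f y = wsum f a b.
Proof.
move=> bN Pab; under eq_bigl do rewrite Pab.
rewrite /wsum [RHS](big_nat_widenl _ 0)// [RHS](big_nat_widen _ _ N)//.
Qed.

Lemma pair_sum_rows H r g f : (forall x, (H <= x)%N -> f x = 0) ->
  pair_sum H r g f = wsum (fun d => g d * wsum f d (d + r)) 0 H.
Proof.
move=> fH; apply: eq_bigr => d _; rewrite -mulr_sumr; congr (_ * _).
have [le|lt] := leqP (d + r) H; first exact: sum_nat_interval.
rewrite (@wsum_widenr _ f d H) ?(ltnW lt)//.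
rewrite big_nat_cond -(@sum_nat_interval _ [pred x | d <= x < H]%N _ _ H)//.
by rewrite [RHS]big_nat_cond; apply: eq_bigl => x /=; lia.
Qed.

(** Grouping by arrival instead of departure: d <= y < d + r means y + 1 - r <= d < y + 1, and
    truncated subtraction gives the right bound because positions start at 0. *)
Lemma pair_sum_cols H r g f : pair_sum H r g f =
  wsum (fun y => f y * wsum g (y.+1 - r) y.+1) 0 H.
Proof.
rewrite /pair_sum (exchange_big_dep xpredT)//= /wsum big_nat [RHS]big_nat.
apply: eq_bigr => y /andP[_ yH]; rewrite mulr_sumr.
under eq_bigr do rewrite mulrC.
by rewrite (@sum_nat_interval (fun d => f y * g d) _ (y.+1 - r) y.+1) => // x;
  lia.
Qed.

Lemma ler_pair_sum H r g f g' f' : (forall x, 0 <= g x) -> (forall x, 0 <= f x)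
  ->
  (forall x, g x <= g' x) -> (forall x, f x <= f' x) ->
  pair_sum H r g f <= pair_sum H r g' f'.
Proof.
move=> g0 f0 gg ff; apply: ler_sum => d _; apply: ler_sum => y _.
exact: ler_pM.
Qed.

Lemma pair_sumDl H r g g' f :
  pair_sum H r (fun x => g x + g' x) f = pair_sum H r g f + pair_sum H r g' f.
Proof.
rewrite -big_split; apply: eq_bigr => d _; rewrite -big_split/=.
by apply: eq_bigr => y _; rewrite mulrDl.
Qed.

Lemma pair_sumDr H r g f f' :
  pair_sum H r g (fun x => f x + f' x) = pair_sum H r g f + pair_sum H r g f'.
Proof.
rewrite -big_split; apply: eq_bigr => d _; rewrite -big_split/=.
by apply: eq_bigr => y _; rewrite mulrDr.
Qed.

Lemma pair_sumZl H r g f c :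
  pair_sum H r (fun x => c * g x) f = c * pair_sum H r g f.
Proof.
rewrite mulr_sumr; apply: eq_bigr => d _; rewrite mulr_sumr.
by apply: eq_bigr => y _; rewrite mulrA.
Qed.

Lemma pair_sumZr H r g f c :
  pair_sum H r g (fun x => c * f x) = c * pair_sum H r g f.
Proof.
rewrite mulr_sumr; apply: eq_bigr => d _; rewrite mulr_sumr.
by apply: eq_bigr => y _; rewrite mulrCA.
Qed.

Lemma pair_sum_le_rows H r g f M : (forall x, 0 <= g x) ->
  (forall x, (H <= x)%N -> f x = 0) ->
  (forall d, wsum f d (d + r) <= M) ->
  pair_sum H r g f <= M * wsum g 0 H.
Proof.
move=> g0 fH fM; rewrite pair_sum_rows// [in leRHS]/wsum mulr_sumr.
by apply: ler_sum => d _; rewrite mulrC ler_wpM2r.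
Qed.

Lemma pair_sum_le_cols H r g f M : (forall x, 0 <= f x) ->
  (forall y, wsum g (y.+1 - r) y.+1 <= M) ->
  pair_sum H r g f <= M * wsum f 0 H.
Proof.
move=> f0 gM; rewrite pair_sum_cols [in leRHS]/wsum mulr_sumr.
by apply: ler_sum => d _; rewrite mulrC ler_wpM2r.
Qed.

Lemma normr_pair_sum_rows H r g f K : (forall x, 0 <= g x) ->
  (forall x, (H <= x)%N -> f x = 0) ->
  (forall x, `|wsum f 0 x| <= K) ->
  `|pair_sum H r g f| <= K *+ 2 * wsum g 0 H.
Proof.
move=> g0 fH fK; rewrite pair_sum_rows// [in leRHS]/wsum mulr_sumr.
apply: (le_trans (ler_norm_sum _ _ _)).
apply: ler_sum => d _;
  rewrite normrM (ger0_norm (g0 _)) [leRHS]mulrC ler_wpM2l//.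
by apply: normr_wsum_le; rewrite ?leq_addr.
Qed.

Lemma normr_pair_sum_cols H r g f K : (forall x, 0 <= f x) ->
  (forall x, `|wsum g 0 x| <= K) ->
  `|pair_sum H r g f| <= K *+ 2 * wsum f 0 H.
Proof.
move=> f0 gK; rewrite pair_sum_cols [in leRHS]/wsum mulr_sumr.
apply: (le_trans (ler_norm_sum _ _ _)).
apply: ler_sum => d _;
  rewrite normrM (ger0_norm (f0 _)) [leRHS]mulrC ler_wpM2l//.
by apply: normr_wsum_le; rewrite ?leq_subr.
Qed.

End pair_sums.

(** * Lists of level values under cutting and stacking *)

Section copies.
Context {T : Type}.
Implicit Types (s : seq T).

Definition copies s n : seq T := flatten (nseq n s).

Lemma size_copies s n : size (copies s n) = (n * size s)%N.
Proof. by rewrite size_flatten /shape map_nseq sumn_nseq mulnC. Qed.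

Lemma copiesS s n : copies s n.+1 = s ++ copies s n.
Proof. by []. Qed.

Lemma copiesD s n m : copies s (n + m) = copies s n ++ copies s m.
Proof. by rewrite /copies nseqD flatten_cat. Qed.

Lemma copiesM s n m : copies (copies s n) m = copies s (m * n).
Proof. by elim: m => // m IH; rewrite copiesS IH mulSn copiesD. Qed.

Lemma nth_copies x0 s n i : (i < n * size s)%N ->
  nth x0 (copies s n) i = nth x0 s (i %% size s).
Proof.
elim: n i => [|n IH] i; first by rewrite mul0n.
rewrite mulSn copiesS nth_cat => lt; case: ltnP => [/modn_small ->//|le].
rewrite IH; last by rewrite ltn_subLR.
by rewrite -[in RHS](subnK le) modnDr.
Qed.

End copies.

Section lists.
Context {R : realFieldType}.
Implicit Types (s u : seq R).

Definition total s : R := \sum_(z <- s) z.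

Lemma total_cat s u : total (s ++ u) = total s + total u.
Proof. exact: big_cat. Qed.

Lemma total_zeros n : total (nseq n 0) = 0.
Proof. by rewrite /total big_nseq; elim: n => //= n ->; rewrite addr0. Qed.

Lemma total_copies s n : total (copies s n) = n%:R * total s.
Proof.
elim: n => [|n IH]; first by rewrite mul0r /total /copies big_nil.
by rewrite copiesS total_cat IH -natr1 mulrDl mul1r addrC.
Qed.

Lemma wsum_nth s x : wsum (nth 0 s) 0 x = total (take x s).
Proof.
rewrite /wsum /total; elim: s x => [|a s IH] [|x]; rewrite /= ?big_nil//.
- by rewrite big1// => i _; rewrite nth_nil.
- by rewrite big_nat_recl//= big_cons -IH.
Qed.

Lemma wsum_nth_total s x : (size s <= x)%N -> wsum (nth 0 s) 0 x = total s.
Proof. by move=> sx; rewrite wsum_nth take_oversize. Qed.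

(** The zero total makes partial sums start afresh in each concatenated list, so the same K survives
    any number of copies. *)
Definition balanced (K : R) s :=
  total s = 0 /\ forall x, `|total (take x s)| <= K.

Lemma balanced_ge0 K s : balanced K s -> 0 <= K.
Proof. by case=> _ /(_ 0%N); apply: le_trans. Qed.

Lemma balanced_nil (K : R) : 0 <= K -> balanced K [::].
Proof. by split; rewrite /= /total big_nil// normr0. Qed.

Lemma balanced_cat K s u : balanced K s -> balanced K u -> balanced K (s ++ u).
Proof.
move=> [s0 sK] [u0 uK]; split=> [|x]; first by rewrite total_cat s0 u0 addr0.
by rewrite take_cat; case: ltnP => // _; rewrite total_cat s0 add0r.
Qed.

Lemma balanced_zeros (K : R) n : 0 <= K -> balanced K (nseq n 0).
Proof.
move=> K0; elim: n => [|n IH]; first exact: balanced_nil.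
apply: (@balanced_cat K [:: 0] (nseq n 0)) => //; split=> [|[|x]].
- by rewrite /total big_seq1.
- by rewrite take0 /total big_nil normr0.
- by rewrite /= /total big_seq1 normr0.
Qed.

Lemma balanced_copies K s n : balanced K s -> balanced K (copies s n).
Proof.
move=> sK; elim: n => [|n IH]; first exact: (balanced_nil (balanced_ge0 sK)).
by rewrite copiesS; apply: balanced_cat.
Qed.

Lemma nth_ge0 s i : (forall x, x \in s -> 0 <= x) -> 0 <= nth 0 s i.
Proof.
by move=> s0; case: (ltnP i (size s)) => ?;
  [exact/s0/mem_nth|rewrite nth_default].
Qed.

(* If s lists the values of a function on the levels of C_n, and the function
   vanishes on the new spacers, this lists its values on the levels of C_(n+1);
   here n stands for k_n - 1. *)
Definition next_list s (l n m : nat) : seq R :=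
  let v := copies (s ++ nseq l 0) (m * n) ++ copies s m in
  v ++ nseq (size v) 0.

Lemma size_next_list s l n m :
  size (next_list s l n m) = (2 * (m * n * (size s + l) + m * size s))%N.
Proof.
rewrite /next_list size_cat size_nseq addnn -mul2n size_cat !size_copies.
by rewrite size_cat size_nseq.
Qed.

Lemma balanced_next_list K s l n m : balanced K s ->
  balanced K (next_list s l n m).
Proof.
move=> sK; have z p := balanced_zeros p (balanced_ge0 sK).
by do ![apply: balanced_cat => //|apply: balanced_copies => //].
Qed.

Lemma total_next_list s l n m :
  total (next_list s l n m) = (m * n.+1)%:R * total s.
Proof.
rewrite /next_list !total_cat !total_copies !total_cat !total_zeros.
by rewrite !addr0 -mulrDl -natrD mulnS addnC.
Qed.

End lists.

Section periodic.
Context {R : realFieldType}.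
Implicit Types (s : seq R) (f : nat -> R).

Lemma wsum_shift f P a b :
  wsum (fun x => if (x < P)%N then 0 else f (x - P)%N) a b =
  wsum f (a - P) (b - P).
Proof.
elim: b => [|b IH]; first by rewrite sub0n /wsum !big_geq.
have [ab|ba] := leqP a b; last by rewrite /wsum !big_geq//; lia.
rewrite (@wsum_cat _ _ a b b.+1) ?ab ?leqnSn// IH /wsum big_nat1.
case: ltnP => [bP|Pb].
  rewrite addr0 !big_geq//; lia.
by rewrite subSn// [RHS]big_nat_recr//=; lia.
Qed.

Lemma wsum_period s x : (0 < size s)%N ->
  wsum (fun i => nth 0 s (i %% size s)) x (x + size s) = total s.
Proof.
move=> s0; elim: x => [|x IH].
  rewrite -(wsum_nth_total (leqnn _)) add0n /wsum big_nat [RHS]big_nat.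
  by apply: eq_bigr => i /andP[_ /modn_small ->].
apply: (addrI (nth 0 s (x %% size s))); rewrite -[in RHS]IH.
have := @wsum_cat _ (fun i => nth 0 s (i %% size s)) x x.+1 (x + size s).+1.
rewrite {2}/wsum big_nat1 => <-; last by lia.
rewrite (@wsum_cat _ _ x (x + size s)); last by lia.
by rewrite [X in _ + X]/wsum big_nat1 modnDr addrC.
Qed.

(** A window of one period of the periodic extension of [s] meets each entry exactly once; the
    finite list lies below that extension. *)
Lemma wsum_copies_le s M x : (forall z, z \in s -> 0 <= z) -> (0 < size s)%N ->
  wsum (nth 0 (copies s M)) x (x + size s) <= total s.
Proof.
move=> s0 ss; rewrite -(wsum_period x ss); apply: ler_wsum => i _.
have [lt|le] := ltnP i (M * size s)%N; first by rewrite nth_copies.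
by rewrite nth_default ?nth_ge0// size_copies.
Qed.

End periodic.

(** * Upper and lower bounds for pair sums over one step *)

Section next_list_pairs.
Context {R : realFieldType}.
Variables (s : seq R) (l L n m h0 r : nat).
Hypothesis s_ge0 : forall z, z \in s -> 0 <= z.
Hypothesis s_top : forall i, (h0 <= i)%N -> nth 0 s i = 0.
Hypothesis h0_le : (h0 <= size s)%N.
Hypothesis h_gt0 : (0 < size s)%N.
Hypothesis lE : l = (L * size s)%N.
Hypothesis n_gt0 : (0 < n)%N.
Hypothesis m_gt0 : (0 < m)%N.
Hypothesis h0r : (h0 <= r)%N.

Let q := total s.
Let X := size (s ++ nseq l 0).
Let P := (m * n * X)%N.
Let H := (P + m * size s)%N.
(* u1 and u2 are the contributions of the sparse part (copies of C_n at distance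
   h_n + l_n) and of the dense part (copies at distance h_n); a window of
   length r meets about t copies of the sparse part. *)
Let u1 := nth 0 (copies (s ++ nseq l 0) (m * n)).
Let u2 x := if (x < P)%N then 0 else nth 0 (copies s m) (x - P).
Let u := nth 0 (next_list s l n m).
Let t := minn (m * n) ((r - h0) %/ X).+1.

Let XE : X = (L.+1 * size s)%N.
Proof. by rewrite /X size_cat size_nseq lE mulSn. Qed.

Let X_gt0 : (0 < X)%N.
Proof. by rewrite XE muln_gt0. Qed.

Let q_ge0 : 0 <= q.
Proof. by rewrite /q /total big_seq sumr_ge0. Qed.

Let sl_ge0 z : z \in s ++ nseq l 0 -> 0 <= z.
Proof.
by rewrite mem_cat => /orP[/s_ge0//|]; rewrite mem_nseq => /andP[_ /eqP->].
Qed.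

Let copies_ge0 (s' : seq R) N z : (forall z, z \in s' -> 0 <= z) ->
  z \in copies s' N -> 0 <= z.
Proof.
move=> s'0 /flattenP[s'' ]; rewrite mem_nseq => /andP[_ /eqP->]; exact: s'0.
Qed.

Let u1_ge0 x : 0 <= u1 x.
Proof. by apply: nth_ge0 => z; apply: copies_ge0. Qed.

Let u2_ge0 x : 0 <= u2 x.
Proof. by rewrite /u2; case: ifP => // _; apply: nth_ge0 => z;
  apply: copies_ge0. Qed.

Let u1_out x : (P <= x)%N -> u1 x = 0.
Proof. by move=> Px; rewrite /u1 nth_default// size_copies. Qed.

Let uE x : u x = u1 x + u2 x.
Proof.
rewrite /u /next_list -catA nth_cat size_copies -/X -/P /u2.
case: ltnP => [_|Px]; first by rewrite addr0.
rewrite u1_out// add0r nth_cat; case: ltnP => // ?.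
by rewrite nth_nseq [RHS]nth_default//; case: ifP.
Qed.

Let u_ge0 x : 0 <= u x.
Proof. by rewrite uE addr_ge0. Qed.

Let t_gt0 : (0 < t)%N.
Proof. by rewrite /t leq_min muln_gt0 m_gt0 n_gt0. Qed.

Let totX : total (s ++ nseq l 0) = q.
Proof. by rewrite total_cat total_zeros addr0. Qed.

Let sum_u1_le a b : wsum u1 a b <= (m * n)%:R * q.
Proof.
apply: (le_trans (@wsum_le_widen _ u1 a b 0 (maxn b P) _ _ _)) => //.
  exact: leq_maxl.
by rewrite wsum_nth_total ?total_copies ?totX// size_copies leq_maxr.
Qed.

Let sum_u2_le a b : wsum u2 a b <= m%:R * q.
Proof.
rewrite /u2 wsum_shift.
apply: (le_trans (@wsum_le_widen _ _ _ _ 0 (maxn b (m * size s)) _ _ _)) => //.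
- by move=> x; apply: nth_ge0 => z; apply: copies_ge0.
- by rewrite leq_max leq_subr.
- by rewrite wsum_nth_total ?total_copies// size_copies leq_maxr.
Qed.

(** If t = m n, the whole sparse part has total t q. Otherwise r %/ X + 1 periods cover the window,
    and passing from r to r - h0 changes the quotient by at most 1 because h0 <= X. *)
Let window_u1 a b : (b <= a + r)%N -> wsum u1 a b <= (2 * t)%:R * q.
Proof.
move=> br; have [tM|tr] : t = (m * n)%N \/ t = ((r - h0) %/ X).+1.
  by rewrite /t; lia.
- apply: (le_trans (sum_u1_le a b)); rewrite ler_wpM2r// ler_nat tM; lia.
- apply: (le_trans (@wsum_le_quot _ u1 X q a b r X_gt0 u1_ge0 _ br)).
    by move=> x; rewrite -totX wsum_copies_le//.
  rewrite ler_wpM2r// ler_nat tr.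
  have : (r %/ X <= ((r - h0) + X) %/ X)%N.
    apply: leq_div2r; have : (h0 <= X)%N by rewrite XE mulSn; lia.
    lia.
  rewrite divnDr// divnn X_gt0; lia.
Qed.

(** The dense part has period [size s] instead of X = L.+1 * size s, hence the extra factor L.+1. *)
Let window_u2 a b : (b <= a + r)%N -> wsum u2 a b <= (2 * L.+1 * t)%:R * q.
Proof.
move=> br; have [tM|tr] : t = (m * n)%N \/ t = ((r - h0) %/ X).+1.
  by rewrite /t; lia.
- apply: (le_trans (sum_u2_le a b)); rewrite ler_wpM2r// ler_nat tM; nia.
- apply: (le_trans (@wsum_le_quot _ u2 (size s) q a b r h_gt0 u2_ge0 _ br)).
    move=> x; rewrite /u2 wsum_shift.
    apply: le_trans (wsum_copies_le m (x - P) s_ge0 h_gt0).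
    apply: wsum_le_widen => //; last by lia.
    by move=> y; apply: nth_ge0 => z; apply: copies_ge0.
  rewrite ler_wpM2r// ler_nat.
  have lt1 : (r - h0 < t * X)%N by rewrite tr ltn_ceil.
  have h0X : (h0 <= X)%N by rewrite XE mulSn; lia.
  have : (r %/ size s < t.+1 * L.+1)%N.
    by rewrite ltn_divLR// -mulnA -XE mulSn; lia.
  move: t_gt0; nia.
Qed.

(** The dense part has mass at most m q, and the window behind each arrival holds at most 2 t q from
    the sparse part and 2 L.+1 t q from the dense one; together this gives 2 t L.+2. *)
Lemma pair_sum_second_le :
  pair_sum H r u u2 <= (m * (2 * t * L.+2))%:R * q ^+ 2.
Proof.
apply: (le_trans (@pair_sum_le_cols _ H r u u2 ((2 * t * L.+2)%:R * q) _ _)) =>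
  //.
  move=> y; have le : (y.+1 <= y.+1 - r + r)%N by lia.
  rewrite (_ : wsum u _ _ = wsum u1 (y.+1 - r) y.+1 + wsum u2 (y.+1 - r) y.+1).
    apply: (le_trans (lerD (window_u1 le) (window_u2 le))).
    by rewrite -mulrDl -natrD ler_wpM2r// ler_nat; lia.
  by rewrite -wsumD /wsum; apply: eq_bigr.
apply: (le_trans (ler_wpM2l _ (sum_u2_le 0 H))); first by rewrite mulr_ge0.
by rewrite le_eqVlt; apply/orP; left; apply/eqP; rewrite natrM; ring.
Qed.

(** Cut the sparse part into B blocks of t copies. Within a block the mass sits in the first Z0
    positions, since the upper half of its last copy is empty, and Z0 <= r: all ordered pairs inside
    the block count. They give at least (t q)^2 / 2 per block, and B t >= m n / 2. *)
Lemma pair_sum_ge :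
  (m * n * t)%:R * q ^+ 2 <= 4 * pair_sum H r u u.
Proof.
pose Z := (t * X)%N; pose B := (m * n %/ t)%N; pose Z0 := (t.-1 * X + h0)%N.
pose v := nth 0 (copies (s ++ nseq l 0) t).
have tM : (t <= m * n)%N by rewrite /t geq_minl.
have Z0r : (Z0 <= r)%N.
  have : (t.-1 * X <= r - h0)%N.
    by rewrite (leq_trans _ (leq_trunc_div (r - h0) X))// leq_mul2r /t; lia.
  rewrite /Z0; lia.
have h0X : (h0 <= X)%N by rewrite XE mulSn; lia.
have Z0Z : (Z0 <= Z)%N.
  by rewrite /Z0 /Z -{2}(prednK t_gt0) mulSn addnC leq_add2r.
have v_ge0 i : 0 <= v i by apply: nth_ge0 => z; apply: copies_ge0.
have v_out i : (Z0 <= i)%N -> v i = 0.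
  move=> Zi; have [iZ|Zi'] := ltnP i Z;
    last by rewrite /v nth_default// size_copies.
  rewrite /v nth_copies//.
  have iE : i = (t.-1 * X + (i - t.-1 * X))%N by rewrite subnKC//; lia.
  have lt : (i - t.-1 * X < X)%N.
    rewrite ltn_subLR; first by rewrite [X in (_ < X)%N]addnC -mulSn prednK.
    by lia.
  rewrite {1}iE modnMDl modn_small//.
  rewrite nth_cat; case: ltnP => _; last by rewrite nth_nseq; case: ifP.
  by apply: s_top; rewrite -(leq_add2l (t.-1 * X)) -iE.
have BP : (B * Z <= P)%N.
  by rewrite /B /Z mulnA leq_mul2r leq_trunc_div orbT.
have vu b i : (b < B)%N -> v i <= u1 (b * Z + i)%N.
  move=> bB; have [iZ|Zi] := ltnP i Z; last by rewrite v_out ?(leq_trans Z0Z).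
  rewrite /v /u1 !nth_copies//; last first.
    apply: leq_trans BP; apply: (@leq_trans (b.+1 * Z));
      last by rewrite leq_mul2r bB orbT.
    by rewrite mulSn addnC ltn_add2r.
  by rewrite /Z mulnA modnMDl.
have half : (t%:R * q) ^+ 2 <= 2 * wsum (fun x => v x * wsum v x Z) 0 Z.
  have <- : wsum v 0 Z = t%:R * q.
    by rewrite wsum_nth_total ?total_copies ?totX// size_copies leqnn.
  by rewrite mulr_natl wsum_half_square.
have blocks : B%:R * wsum (fun x => v x * wsum v x Z) 0 Z <= pair_sum H r u u.
  apply: (@le_trans _ _ (pair_sum H r u1 u1)); last first.
    by apply: ler_pair_sum => // x; rewrite uE lerDl.
  rewrite pair_sum_rows; last by move=> x Hx; apply: u1_out; rewrite /H in Hx;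
    lia.
  apply: (@le_trans _ _ (wsum (fun d => u1 d * wsum u1 d (d + r)) 0 (B * Z))).
    rewrite wsum_blocks mulr_natl.
    rewrite -[X in _ *+ X]subn0 -sumr_const_nat [leLHS]big_nat [leRHS]big_nat.
    apply: ler_sum => b /andP[_ bB]; apply: ler_wsum => i iZ.
    apply: ler_pM => //; [exact: wsum_ge0|exact: vu|].
    apply: (@le_trans _ _ (wsum (fun j => u1 (b * Z + j)%N) i (i + r))).
      apply: (@le_trans _ _ (wsum v i (i + r))); last first.
        by apply: ler_wsum => j _; exact: vu.
      rewrite (@wsum_widenr _ _ _ Z0 Z)//; apply: wsum_le_widen => //; lia.
    rewrite /wsum -addnA [in leRHS]addnC big_addn.
    rewrite (_ : b * Z + (i + r) - b * Z = i + r)%N; last by lia.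
    by apply: ler_sum => j _; rewrite addnC.
  apply: wsum_le_widen => //; first by move=> x; rewrite mulr_ge0// wsum_ge0.
  by apply: (leq_trans BP); rewrite /H leq_addr.
(* Rounding m n / t down loses at most half because B >= 1, that is, t <= m n. *)
have Bt : (m * n <= 2 * (B * t))%N.
  have := ltn_ceil (m * n) t_gt0; rewrite -/B mulSn.
  have : (0 < B)%N by rewrite divn_gt0.
  nia.
have : (m * n * t)%:R * q ^+ 2 <= (2 * B)%:R * (t%:R * q) ^+ 2.
  rewrite exprMn [leRHS]mulrA ler_wpM2r ?sqr_ge0// -natrX -natrM ler_nat.
  by rewrite expnS expn1 mulnA leq_mul2r; apply/orP; right; rewrite -mulnA.
move=> /le_trans; apply; rewrite natrM.
have := ler_wpM2l (ler0n R B) half.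
move: blocks; set W := wsum _ 0 Z; set S := (t%:R * q) ^+ 2; nra.
Qed.

(** Multiplication by m n q turns the factor t q into m n t q^2, which [pair_sum_ge] bounds by 4
    times the pair sum; so t disappears, and 8 = 2 * 4. *)
Let uniform_bound (a1 a2 e : R) : 0 <= e -> 0 <= a2 ->
  a1 <= (2 * t)%:R * q * e + a2 * ((m * (2 * t * L.+2))%:R * q ^+ 2) ->
  (m * n)%:R * q * a1 <=
  8 * (e + a2 * (L.+2 * m)%:R * q) * pair_sum H r u u.
Proof.
move=> e0 a20 /(ler_wpM2l (mulr_ge0 (ler0n _ (m * n)) q_ge0)) /le_trans; apply.
have c0 : 0 <= e + a2 * (L.+2 * m)%:R * q by rewrite addr_ge0// !mulr_ge0.
have := ler_wpM2l c0 pair_sum_ge; rewrite !natrM.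
set S := pair_sum _ _ _ _; nra.
Qed.

Lemma pair_sum_rows_uniform (w : R) e : 0 <= w -> (forall x, 0 <= e x <= w * u
  x) ->
  (m * n)%:R * q * pair_sum H r e u <=
  8 * (wsum e 0 H + w * (L.+2 * m)%:R * q) * pair_sum H r u u.
Proof.
move=> w0 eu; apply: uniform_bound => //.
  by apply: wsum_ge0 => x; case/andP: (eu x).
apply: (@le_trans _ _ (pair_sum H r e (fun x => u1 x + u2 x))).
  by apply: ler_pair_sum => // x; [case/andP: (eu x)|rewrite uE].
rewrite pair_sumDr lerD//.
  apply: pair_sum_le_rows => [x|x Hx|d]; first by case/andP: (eu x).
    by apply: u1_out; rewrite /H in Hx; lia.
  exact: window_u1.
apply: le_trans (ler_wpM2l w0 pair_sum_second_le).
by rewrite -pair_sumZl; apply: ler_pair_sum => // x; case/andP: (eu x).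
Qed.

(** Here [e] weights the arrivals, so it is [e] that is split at P; its part above P is dominated by
    w u2 and falls under [pair_sum_second_le]. *)
Lemma pair_sum_cols_uniform (w : R) e : 0 <= w -> (forall x, 0 <= e x <= w * u
  x) ->
  (m * n)%:R * q * pair_sum H r u e <=
  8 * (wsum e 0 H + w * (L.+2 * m)%:R * q) * pair_sum H r u u.
Proof.
move=> w0 eu; apply: uniform_bound => //.
  by apply: wsum_ge0 => x; case/andP: (eu x).
pose e1 x := if (x < P)%N then e x else 0;
  pose e2 x := if (x < P)%N then 0 else e x.
have eE : e = (fun x => e1 x + e2 x) :> (nat -> R).
  by apply/funext => x; rewrite /e1 /e2; case: ifP; rewrite ?addr0 ?add0r.
have e10 x : 0 <= e1 x by rewrite /e1; case: ifP => // _; case/andP: (eu x).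
have e1e x : e1 x <= e x by rewrite /e1; case: ifP => // _; case/andP: (eu x).
rewrite {1}eE pair_sumDr lerD//.
  (* An arrival in the sparse part departs from a lower or equal position, hence also from the
     sparse part, since the dense part is stacked above it. *)
  have -> : pair_sum H r u e1 = pair_sum H r u1 e1.
    apply: eq_bigr => d _; apply: eq_bigr => y /andP[dy _].
    rewrite uE /u2 /e1; case: ltnP => // Pd; first by rewrite addr0.
    by rewrite ltnNge (leq_trans Pd dy) !mulr0.
  apply: (@le_trans _ _ ((2 * t)%:R * q * wsum e1 0 H)).
    by apply: pair_sum_le_cols => // y; apply: window_u1; lia.
  by rewrite ler_wpM2l ?mulr_ge0//; apply: ler_wsum.
apply: le_trans (ler_wpM2l w0 pair_sum_second_le).
rewrite -pair_sumZr; apply: ler_pair_sum => // x.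
  by rewrite /e2; case: ifP => // _; case/andP: (eu x).
rewrite /e2; case/andP: (eu x) => _; rewrite uE /u2; case: ltnP => [_ _|Px].
  by rewrite mulr0.
by rewrite u1_out// add0r.
Qed.

End next_list_pairs.

(** * One step of cutting and stacking *)

Section cutting.
Context {R : realType}.
Implicit Types (w x a : R) (s : seq R) (C D : column (R := R)).

(* Counting the levels over a point makes cutting and stacking additive, and a
   column has disjoint levels when no count exceeds 1. *)
Definition mult w s x : nat := count (fun a => a <= x < a + w) s.

Definition cut w s r i : seq R := [seq a + i%:R * (w / r%:R) | a <- s].

Lemma mult_cat w s1 s2 x : mult w (s1 ++ s2) x = (mult w s1 x + mult w s2 x)%N.
Proof. exact: count_cat. Qed.

Lemma mult_flatten w (I : Type) (t : seq I) (F : I -> seq R) x :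
  mult w (flatten [seq F i | i <- t]) x = (\sum_(i <- t) mult w (F i) x)%N.
Proof.
elim: t => [|i t IH]; first by rewrite big_nil.
by rewrite big_cons -IH /= mult_cat.
Qed.

Lemma sum_consecutive_cells (c : nat -> R) r x : {homo c : i j / (i <= j)%N >->
  i <= j} ->
  (\sum_(0 <= i < r) (c i <= x < c i.+1)%R)%N = (c 0 <= x < c r)%R :> nat.
Proof.
move=> cle; elim: r => [|r IH].
  by rewrite big_geq//; case: (leP (c 0%N) x); case: (ltP x (c 0%N)) => //= *;
    exfalso; lra.
rewrite big_nat_recr//= {}IH.
have := cle 0%N r (leq0n _); have := cle r r.+1 (leqnSn _).
case: (leP (c 0%N) x); case: (ltP x (c r)); case: (leP (c r) x);
  case: (ltP x (c r.+1)) => //= *; exfalso; lra.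
Qed.

Lemma cut_endpointS w r i a :
  a + i.+1%:R * (w / r%:R) = a + i%:R * (w / r%:R) + w / r%:R.
Proof. by rewrite -natr1; ring. Qed.

Lemma cut_endpoint_last w r a : (0 < r)%N -> a + r%:R * (w / r%:R) = a + w.
Proof. by move=> r0; rewrite mulrCA divff ?mulr1// pnatr_eq0 -lt0n. Qed.

Lemma cut_endpoint_homo w r a : 0 < w ->
  {homo (fun i => a + i%:R * (w / r%:R)) : i j / (i <= j)%N >-> i <= j}.
Proof.
move=> w0 i j ij; rewrite lerD2l ler_wpM2r ?ler_nat//.
by rewrite divr_ge0 ?(ltW w0)//.
Qed.

Lemma mult_cut w r s x : 0 < w -> (0 < r)%N ->
  (\sum_(0 <= i < r) mult (w / r%:R) (cut w s r i) x)%N = mult w s x.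
Proof.
move=> w0 r0; elim: s => [|a s IH].
  by rewrite /mult /= big1.
have := sum_consecutive_cells r x (@cut_endpoint_homo w r a w0).
rewrite /= cut_endpoint_last// mul0r addr0 => <-; rewrite -IH -big_split/=.
by apply: eq_bigr => i _; rewrite cut_endpointS.
Qed.

Lemma mult_gt0P w s x :
  reflect (exists2 a, a \in s & a <= x < a + w) (0 < mult w s x)%N.
Proof. by rewrite /mult -has_count; apply: hasP. Qed.

Lemma supportP C x : support C x <-> (0 < mult (width C) (endpoints C) x)%N.
Proof.
split=> [[i /= iC xi]|/mult_gt0P[a aC ax]].
  by apply/mult_gt0P; exists (left_end C i) => //; apply: mem_nth.
exists (index a (endpoints C)); first by rewrite /= /height index_mem.
by rewrite /level /= /left_end nth_index.
Qed.

Lemma support_mult0 C x : ~ support C x -> mult (width C) (endpoints C) x = 0%N.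
Proof. by move=> /supportP/negP; rewrite lt0n negbK => /eqP. Qed.

Lemma count_le1P (T : Type) (x0 : T) (p : pred T) (s : seq T) :
  (count p s <= 1)%N <->
  (forall i j, (i < j < size s)%N -> p (nth x0 s i) -> p (nth x0 s j) -> False).
Proof.
elim: s => [|a s IH]; first by split=> // _ i j /andP[].
rewrite /=; split=> [le [|i] [|j] //=|H].
- rewrite ltnS => js pa pj; move: le; rewrite pa.
  have : has p s by apply/(has_nthP x0); exists j.
  by rewrite has_count; lia.
- by move=> ij; apply: (IH.1 _ i j); [move: le; case: (p a); lia|lia].
- have le1 : (count p s <= 1)%N.
    by apply/IH => i j ij; apply: (H i.+1 j.+1).
  case pa : (p a); last by rewrite add0n.
  rewrite add1n ltnS leqNgt -has_count.
  apply/negP => /(has_nthP x0)[j js pj].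
  by apply: (H 0%N j.+1).
Qed.

Lemma disjoint_levelsP C : disjoint_levels C <->
  (forall x, (mult (width C) (endpoints C) x <= 1)%N).
Proof.
split=> [tC x|C1].
  apply/(count_le1P 0) => i j /andP[ij jC] xi xj.
  have : i = j by apply: tC => //=; [exact: ltn_trans jC|exists x].
  by move=> e; rewrite e ltnn in ij.
apply/trivIsetP => i j /= iC jC ij; rewrite -subset0 => x [xi xj].
have /(count_le1P 0) H := C1 x.
by case: (ltngtP i j) ij => // ij _; [apply: (H i j)|apply: (H j i)];
  rewrite ?ij.
Qed.

Definition levelwise w (f : R -> R) s :=
  forall a x, a \in s -> a <= x < a + w -> f x = f a.

Lemma levelwise_cat w f s1 s2 :
  levelwise w f s1 -> levelwise w f s2 -> levelwise w f (s1 ++ s2).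
Proof. by move=> h1 h2 a x; rewrite mem_cat => /orP[/h1|/h2]; apply. Qed.

Lemma levelwise_flatten w f (I : eqType) (t : seq I) (F : I -> seq R) :
  (forall i, i \in t -> levelwise w f (F i)) ->
  levelwise w f (flatten [seq F i | i <- t]).
Proof. by move=> h a x /flatten_mapP[i it aF]; exact: h aF. Qed.

Lemma cut_cell_sub w r i a x : 0 < w -> (i < r)%N ->
  a + i%:R * (w / r%:R) <= x < a + i%:R * (w / r%:R) + w / r%:R ->
  a <= x < a + w.
Proof.
move=> w0 ir; have r0 : (0 < r)%N by exact: leq_ltn_trans ir.
have := cut_endpoint_homo r a w0 (leq0n i).
have := cut_endpoint_homo r a w0 ir.
by rewrite cut_endpointS cut_endpoint_last// mul0r addr0; lra.
Qed.

Lemma cut_endpoint_sub w r i a : 0 < w -> (i < r)%N ->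
  a <= a + i%:R * (w / r%:R) < a + w.
Proof.
move=> w0 ir; apply: (cut_cell_sub w0 ir).
by rewrite lexx ltrDl divr_gt0// ltr0n; exact: leq_ltn_trans ir.
Qed.

Lemma levelwise_cut w f s r i : 0 < w -> (i < r)%N ->
  levelwise w f s -> levelwise (w / r%:R) f (cut w s r i).
Proof.
move=> w0 ir fs a x /mapP[b bs ->] /(cut_cell_sub w0 ir) bx.
by rewrite (fs b x)// (fs b)// cut_endpoint_sub.
Qed.

Lemma map_cut w f s r i : 0 < w -> (i < r)%N ->
  levelwise w f s -> map f (cut w s r i) = map f s.
Proof.
move=> w0 ir fs; rewrite -map_comp; apply/eq_in_map => a as_ /=.
by apply: fs => //; exact: cut_endpoint_sub.
Qed.

End cutting.

Lemma map_eq_nseq (T U : eqType) (g : T -> U) c (s : seq T) :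
  (forall a, a \in s -> g a = c) -> map g s = nseq (size s) c.
Proof.
move=> gc; rewrite -(size_map g s);
  apply/all_pred1P/allP => _ /mapP[a /gc ga ->].
by rewrite /= ga.
Qed.

Section next_column_step.
Context {R : realType}.
Variables (k l m : nat) (C C' : column (R := R)).
Hypothesis k_gt0 : (0 < k)%N.
Hypothesis m_gt0 : (0 < m)%N.
Hypothesis width_gt0 : 0 < width C.
Hypothesis next : next_column k l m C C'.

Let w := width C / k%:R.
Let w_gt0 : 0 < w. Proof. by rewrite divr_gt0// ltr0n. Qed.
Let base (S : nat -> seq R) := flatten
  [seq cut (width C) (endpoints C) k i ++ S i | i <- iota 0 k.-1].
Let last := cut (width C) (endpoints C) k k.-1.

(** Unfolds [next_column] once and for all: nested stacks become flat lists of endpoints, and the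
    newness of the spacers becomes bounds on [mult]. *)
Lemma next_columnE : exists (S : nat -> seq R) (U : seq R),
  let s := flatten [seq S i | i <- iota 0 k.-1] in
  [/\ width C' = w / m%:R,
      endpoints C' = flatten [seq cut w (base S) m j | j <- iota 0 m] ++
        flatten [seq cut w last m j | j <- iota 0 m] ++ U,
      (forall i, (i < k.-1)%N -> size (S i) = l) /\
      size U = (m * (height C + l) * k.-1 + m * height C)%N,
      forall x, (mult w s x <= 1)%N /\
        ((0 < mult w s x)%N -> mult (width C) (endpoints C) x = 0%N) &
      forall x, (mult (w / m%:R) U x <= 1)%N /\
        ((0 < mult (w / m%:R) U x)%N ->
        mult (width C) (endpoints C) x = 0%N /\ mult w s x = 0%N)].
Proof.
case: next => S [U] [sizeS [/disjoint_levelsP dS SC] sizeU [/disjoint_levelsP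
  dU UC] ->].
exists S, U => s.
have sE : endpoints (stack w [seq Column w (S i) | i <- iota 0 k.-1]) = s.
  by rewrite /= -map_comp.
rewrite -/w in dS SC dU UC; split => //.
- rewrite /= cats0 -!map_comp; congr (flatten _ ++ _); apply: eq_map => j /=.
  congr (cut _ _ _ _); rewrite -map_comp /base; congr flatten.
  by apply: eq_map => i /=; rewrite cats0.
- move=> x; have := dS x; rewrite sE => S1; split=> // sx.
  apply: support_mult0 => Cx; have : [set: R] x by [].
  suff : (set0 : set R) x by []. 
  rewrite -SC; split=> //; apply/supportP; by rewrite sE.
- move=> x; split; first exact: dU.
  move=> Ux; have Ux' : support (Column (w / m%:R) U) x by apply/supportP.
  split.
    apply: support_mult0 => Cx; suff : (set0 : set R) x by [].
    by rewrite -UC; split=> //; left.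
  apply/eqP; rewrite -leqn0 leqNgt; apply/negP => sx.
  suff : (set0 : set R) x by [].
  by rewrite -UC; split=> //; right; apply/supportP; rewrite sE.
Qed.

Lemma width_next : width C' = width C / (k * m)%:R.
Proof. by have [S [U [-> _ _ _ _]]] := next_columnE;
  rewrite /w natrM invfM mulrA. Qed.

Lemma width_next_gt0 : 0 < width C'.
Proof. by rewrite width_next divr_gt0// ltr0n muln_gt0 k_gt0. Qed.

(** Cutting and restacking keep the count over a point; i counts the intermediate spacers over x and
    j the final ones. Growth of the supports and disjointness of levels both follow. *)
Lemma mult_next x : exists i j,
  [/\ mult (width C') (endpoints C') x =
        (mult (width C) (endpoints C) x + i + j)%N,
      (i <= 1)%N /\ ((0 < i)%N -> mult (width C) (endpoints C) x = 0%N) &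
      (j <= 1)%N /\ ((0 < j)%N -> mult (width C) (endpoints C) x = 0%N /\ i =
        0%N)].
Proof.
have [S [U [wE eE _ sx Ux]]] := next_columnE.
exists (mult w (flatten [seq S i | i <- iota 0 k.-1]) x), (mult (w / m%:R) U x).
split; [|exact: sx|exact: Ux].
have cuts s : mult (w / m%:R) (flatten [seq cut w s m j | j <- iota 0 m]) x =
    mult w s x.
  by rewrite mult_flatten -{1}[m]subn0 -/(index_iota 0 m) mult_cut.
rewrite wE eE !mult_cat !cuts addnA; congr addn.
rewrite -(mult_cut (r := k) _ _ width_gt0)// mult_flatten mult_flatten.
rewrite -[k in RHS](prednK k_gt0) big_nat_recr//= prednK// -/w.
rewrite /index_iota subn0 addnAC -big_split/=; congr addn.
by apply: eq_bigr => i _; rewrite mult_cat.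
Qed.

Lemma support_next : support C `<=` support C'.
Proof.
move=> x /supportP Cx; apply/supportP.
by have [i [j [-> _ _]]] := mult_next x; lia.
Qed.

Lemma disjoint_levels_next : disjoint_levels C -> disjoint_levels C'.
Proof.
move=> /disjoint_levelsP C1; apply/disjoint_levelsP => x.
by have [i [j [-> [i1 i0] [j1 j0]]]] := mult_next x; have := C1 x; lia.
Qed.

(** The passage from geometry to lists: every piece of a level inherits its value, and spacers,
    being outside the support of C, receive 0. *)
Lemma next_endpoints_map (f : R -> R) : levelwise (width C) f (endpoints C) ->
  (forall x, ~ support C x -> f x = 0) ->
  levelwise (width C') f (endpoints C') /\
  [seq f a | a <- endpoints C'] =
    next_list [seq f a | a <- endpoints C] l k.-1 m.
Proof.
move=> fC f0; have [S [U [wE eE [sizeS sizeU] sx Ux]]] := next_columnE.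
have f0' x : mult (width C) (endpoints C) x = 0%N -> f x = 0.
  by move=> C0; apply: f0 => /supportP; rewrite C0.
have wm_gt0 : 0 < w / m%:R by rewrite divr_gt0// ltr0n.
have fS i a x : (i < k.-1)%N -> a \in S i -> a <= x < a + w -> f x = 0.
  move=> ik aS ax; apply/f0'/(sx x).2/mult_gt0P; exists a => //.
  by apply/flatten_mapP; exists i => //; rewrite mem_iota.
have fU a x : a \in U -> a <= x < a + w / m%:R -> f x = 0.
  move=> aU ax; suff: (0 < mult (w / m%:R) U x)%N by move=> /(Ux x).2[/f0'].
  by apply/mult_gt0P; exists a.
have self u (a : R) : 0 < u -> a <= a < a + u by move=> u0; rewrite lexx ltrDl.
have mapS i : (i < k.-1)%N -> map f (S i) = nseq l 0.
  move=> ik; rewrite -(sizeS i ik); apply: map_eq_nseq => a aS;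
    apply: (fS i a) => //; exact: self.
have mapU : map f U = nseq (size U) 0.
  apply: map_eq_nseq => a aU; apply: (fU a) => //; exact: self.
have lwS i : (i < k.-1)%N -> levelwise w f (S i).
  by move=> ik a x aS ax; rewrite !(fS i a)//; exact: self.
have lwU : levelwise (w / m%:R) f U.
  by move=> a x aU ax; rewrite !(fU a)//; exact: self.
have lwbase : levelwise w f (base S).
  apply: levelwise_flatten => i; rewrite mem_iota => /andP[_ ik].
  by apply: levelwise_cat; [apply: levelwise_cut => //; lia|exact: lwS].
have lwlast : levelwise w f last by apply: levelwise_cut => //; lia.
split.
  rewrite wE eE; apply: levelwise_cat; last apply: levelwise_cat => //.
    by apply: levelwise_flatten => i; rewrite mem_iota => im;
      apply: levelwise_cut.
  by apply: levelwise_flatten => i; rewrite mem_iota => im;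
    apply: levelwise_cut.
have mapcopies s : levelwise w f s ->
    map f (flatten [seq cut w s m j | j <- iota 0 m]) = copies (map f s) m.
  move=> ls; rewrite map_flatten -map_comp /copies; congr flatten.
  rewrite -[X in nseq X](size_iota 0).
  by apply: map_eq_nseq => j; rewrite mem_iota => jm /=; rewrite map_cut.
have mapbase : map f (base S) = copies (map f (endpoints C) ++ nseq l 0) k.-1.
  rewrite map_flatten -map_comp /copies; congr flatten.
  rewrite -[X in nseq X](size_iota 0).
  apply: map_eq_nseq => i; rewrite mem_iota => /andP[_ ik] /=.
  by rewrite map_cat map_cut//; [rewrite mapS|lia].
have maplast : map f last = map f (endpoints C) by rewrite map_cut//; lia.
rewrite eE !map_cat !mapcopies// mapbase maplast mapU copiesM.
rewrite /next_list catA; congr (_ ++ nseq _ _).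
rewrite sizeU size_cat !size_copies size_cat size_nseq size_map /height.
by rewrite -mulnA (mulnC _ k.-1) mulnA.
Qed.

Lemma height_next :
  height C' = (2 * (m * (height C + l) * k.-1 + m * height C))%N.
Proof.
(* The zero function satisfies the hypotheses trivially, and the sizes of its value lists are the
   heights. *)
have [_ /(congr1 size)] := @next_endpoints_map (fun=> 0) (fun _ _ _ _ => erefl)
  (fun _ _ => erefl).
rewrite size_map size_next_list size_map /height => ->.
by rewrite mulnAC.
Qed.

Lemma head_next : (0 < height C)%N -> left_end C' 0 = left_end C 0.
Proof.
have [S [U [_ eE _ _ _]]] := next_columnE.
rewrite /left_end eE /height.
rewrite -(prednK m_gt0) /= /cut /base /last.
(* For k = 1 the lower part is empty and the bottom level comes from the last subcolumn, which then
   has index 0; in both cases it is a leftmost piece. *)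
case: (k) k_gt0 => // -[|k'] _ /=.
  have -> : flatten [seq [seq a + j%:R * (w / m.-1.+1%:R) | a <- [::]] | j <-
    iota 1 m.-1] = [::] :> seq R.
    by elim: (iota _ _).
  by case: (endpoints C) => // a e _ /=; rewrite !mul0r !addr0.
by case: (endpoints C) => // a e _ /=; rewrite !mul0r !addr0.
Qed.

End next_column_step.

(** * The sequence of columns and the transformation *)

Lemma nth_cat_nseq_top (T : Type) (x0 : T) (v : seq T) i :
  (size (v ++ nseq (size v) x0) <= 2 * i)%N ->
  nth x0 (v ++ nseq (size v) x0) i = x0.
Proof.
rewrite nth_cat size_cat size_nseq nth_nseq => vi.
by rewrite ltnNge (_ : (size v <= i)%N) /=; [case: ifP|lia].
Qed.

Section column_sequence_theory.
Context {R : realType}.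
Variables (k l m : nat -> nat) (C : nat -> column (R := R)).
Hypothesis kmlC : column_sequence k l m C.

Let k0 n : (0 < k n)%N. Proof. by have [] := kmlC.2 n. Qed.
Let m0 n : (0 < m n)%N. Proof. by have [] := kmlC.2 n. Qed.
Let nextC n : next_column (k n) (l n) (m n) (C n) (C n.+1).
Proof. by have [] := kmlC.2 n. Qed.

Lemma width_gt0 n : 0 < width (C n).
Proof.
elim: n => [|n IH]; first by rewrite kmlC.1.1.
exact: (width_next_gt0 (k0 n) (m0 n) IH (nextC n)).
Qed.

Lemma width_succ n : width (C n.+1) = width (C n) / (k n * m n)%:R.
Proof. exact: (width_next (nextC n)). Qed.

Lemma height_succ n : height (C n.+1) =
  (2 * (m n * (height (C n) + l n) * (k n).-1 + m n * height (C n)))%N.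
Proof. exact: (height_next (k0 n) (m0 n) (width_gt0 n) (nextC n)). Qed.

Lemma height_gt0 n : (0 < height (C n))%N.
Proof.
elim: n => [|n IH]; first by rewrite kmlC.1.2.
by rewrite height_succ !muln_gt0/= addn_gt0 muln_gt0 [X in _ || X]muln_gt0 m0
  IH orbT.
Qed.

Lemma disjoint_levels_seq n : disjoint_levels (C n).
Proof.
elim: n => [|n IH]; last exact: (disjoint_levels_next (k0 n) (m0 n) (width_gt0
  n) (nextC n)).
by move=> i j /=; rewrite kmlC.1.2 !ltnS !leqn0 => /eqP-> /eqP->.
Qed.

Lemma level_inj n i j x : (i < height (C n))%N -> (j < height (C n))%N ->
  level (C n) i x -> level (C n) j x -> i = j.
Proof. by move=> ih jh xi xj; apply: (@disjoint_levels_seq n) => //;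
  exists x. Qed.

Lemma subset_support n n' : (n <= n')%N -> support (C n) `<=` support (C n').
Proof.
elim: n' => [|n' IH]; first by rewrite leqn0 => /eqP->.
rewrite leq_eqVlt => /predU1P[->//|/IH]; move=> /subset_trans; apply.
exact: (support_next (k0 n') (m0 n') (width_gt0 n') (nextC n')).
Qed.

Lemma base_seq n : left_end (C n) 0 = left_end (C 0) 0.
Proof.
elim: n => // n <-.
exact: (head_next (k0 n) (m0 n) (nextC n) (height_gt0 n)).
Qed.

Lemma levelwise_levelP n (f : R -> R) : levelwise (width (C n)) f (endpoints (C
  n)) <->
  (forall i x, (i < height (C n))%N -> level (C n) i x -> f x = f (left_end (C
    n) i)).
Proof.
split=> [fC i x ih xi|fC a x aC ax]; first by apply: fC; rewrite ?mem_nth.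
have ia : (index a (endpoints (C n)) < height (C n))%N by rewrite index_mem.
by rewrite (fC _ _ ia); rewrite /level /left_end/= nth_index.
Qed.

(** Vanishing off the column makes these functions stable under passage to later columns, whose new
    spacers get the value 0. *)
Definition column_function n (f : R -> R) :=
  levelwise (width (C n)) f (endpoints (C n)) /\
  forall x, ~ support (C n) x -> f x = 0.

Lemma column_functionS n f : column_function n f -> column_function n.+1 f.
Proof.
move=> [fC f0]; split; last by move=> x Cx;
  apply: f0 => /(subset_support (leqnSn n)).
exact: (next_endpoints_map (k0 n) (m0 n) (width_gt0 n) (nextC n) fC f0).1.
Qed.

Lemma column_function_le n n' f : (n <= n')%N ->
  column_function n f -> column_function n' f.
Proof.
elim: n' => [|n' IH]; first by rewrite leqn0 => /eqP->.
rewrite leq_eqVlt => /predU1P[->//|/IH h] /h; exact: column_functionS.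
Qed.

Definition values n (f : R -> R) := [seq f a | a <- endpoints (C n)].

Lemma size_values n f : size (values n f) = height (C n).
Proof. by rewrite size_map. Qed.

Lemma nth_values n f i : (i < height (C n))%N ->
  nth 0 (values n f) i = f (left_end (C n) i).
Proof. by move=> ih; rewrite (nth_map 0). Qed.

Lemma values_succ n f : column_function n f ->
  values n.+1 f = next_list (values n f) (l n) (k n).-1 (m n).
Proof.
move=> [fC f0].
exact: (next_endpoints_map (k0 n) (m0 n) (width_gt0 n) (nextC n) fC f0).2.
Qed.

Lemma values_level n f i x : column_function n f -> (i < height (C n))%N ->
  level (C n) i x -> f x = nth 0 (values n f) i.
Proof. by move=> [/levelwise_levelP fC _] ih xi;
  rewrite nth_values// (fC i x). Qed.

Lemma column_function_support n : column_function n (\1_(support (C n)) : R ->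
  R).
Proof.
split=> [|x Cx]; last by rewrite indicE memNset.
apply/levelwise_levelP => i x ih xi; rewrite !indicE !mem_set//; exists i => //.
by rewrite /level/= lexx ltrDl width_gt0.
Qed.

Lemma nth_next_list_top (s : seq R) l' n' m' i :
  (size (next_list s l' n' m') <= 2 * i)%N -> nth 0 (next_list s l' n' m') i =
    0.
Proof. exact: nth_cat_nseq_top. Qed.

Lemma values_top n f i : column_function n f -> (height (C n.+1) <= 2 * i)%N ->
  nth 0 (values n.+1 f) i = 0.
Proof.
move=> fn hi; rewrite values_succ//; apply: nth_next_list_top.
by rewrite -values_succ// size_values.
Qed.

(** The upper half of C_(n+1) consists of the final spacers, on which the indicator of the support
    of C_n vanishes. *)
Lemma support_lower_half n i x : (i < height (C n.+1))%N ->
  level (C n.+1) i x -> support (C n) x -> (2 * i < height (C n.+1))%N.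
Proof.
move=> ih xi Cx; rewrite ltnNge; apply/negP => hi.
have := values_top (column_function_support n) hi.
rewrite -(values_level (column_functionS (column_function_support n)) ih xi).
by rewrite indicE mem_set// => /eqP; rewrite oner_eq0.
Qed.

(** The region where C_n prescribes T. These sets increase to X, and on each of their levels T is a
    translation. *)
Definition nontop n : set R :=
  \bigcup_(i in [set i | (i.+1 < height (C n))%N]) level (C n) i.

Lemma nontop_sub n : nontop n `<=` support (C n).
Proof. by move=> x [i /= ih xi]; exists i => //=; exact: ltnW. Qed.

Lemma support_sub_nontop n : support (C n) `<=` nontop n.+1.
Proof.
move=> x Cx; have [i /= ih xi] := subset_support (leqnSn n) Cx.
exists i => //=; have := support_lower_half ih xi Cx.
have := height_gt0 n.+1; rewrite height_succ; lia.
Qed.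

Lemma nontop_homo n n' : (n <= n')%N -> nontop n `<=` nontop n'.
Proof.
elim: n' => [|n' IH]; first by rewrite leqn0 => /eqP->.
rewrite leq_eqVlt => /predU1P[->//|/IH]; move=> /subset_trans; apply.
exact: subset_trans (@nontop_sub n') (@support_sub_nontop n').
Qed.

Section dynamics.
Variables (X : set R) (T : R -> R).
Hypothesis XT : defined_by_columns C X T.

Lemma support_subX n : support (C n) `<=` X.
Proof. by rewrite XT.1 => x Cx; exists n. Qed.

Lemma X_nontop : X = \bigcup_n nontop n.
Proof.
rewrite XT.1; apply/seteqP;
  split=> [x [n _ /support_sub_nontop Cx]|x [n _ /nontop_sub Cx]].
  by exists n.+1.
by exists n.
Qed.

Lemma X_common_nontop x y : X x -> X y -> exists n, nontop n x /\ nontop n y.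
Proof.
rewrite X_nontop => -[n _ nx] [n' _ ny]; exists (maxn n n').
by split; [apply: nontop_homo nx; exact: leq_maxl|apply: nontop_homo ny;
  exact: leq_maxr].
Qed.

Lemma iter_level n i j x : (i + j < height (C n))%N -> level (C n) i x ->
  iter j T x = x + (left_end (C n) (i + j) - left_end (C n) i) /\
  level (C n) (i + j) (iter j T x).
Proof.
elim: j => [|j IH] ij xi; first by rewrite addn0 subrr addr0.
have [|e xij] := IH _ xi; first by lia.
rewrite addnS in ij *; rewrite iterS (XT.2 n (i + j)%N)// e.
split; first by ring.
by move: xi; rewrite /level/=; lra.
Qed.

Lemma T_level n i x : (i.+1 < height (C n))%N -> level (C n) i x ->
  T x = x + (left_end (C n) i.+1 - left_end (C n) i) /\ level (C n) i.+1 (T x).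
Proof. by move=> ih xi; have := @iter_level n i 1 x; rewrite addn1; apply. Qed.

Lemma T_stable x : X x -> X (T x).
Proof.
rewrite {1}X_nontop => -[n _ [i /= ih xi]]; apply: (@support_subX n).
by exists i.+1 => //; exact: (T_level ih xi).2.
Qed.

Lemma iter_stable j x : X x -> X (iter j T x).
Proof. by move=> Xx; elim: j => // j; exact: T_stable. Qed.

Lemma T_inj x y : X x -> X y -> T x = T y -> x = y.
Proof.
move=> Xx Xy Txy; have [n [[i /= ih xi] [j /= jh yj]]] := X_common_nontop Xx Xy.
have [ex xS] := T_level ih xi; have [ey yS] := T_level jh yj.
have [ij] : i.+1 = j.+1 by apply: (level_inj ih jh xS); rewrite Txy.
by move: Txy; rewrite ex ey ij => /addIr.
Qed.

Let a := left_end (C 0) 0.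

Lemma base_level n : level (C n) 0 a.
Proof. by rewrite /level/= base_seq lexx ltrDl width_gt0. Qed.

Lemma baseX : X a.
Proof. by apply: (@support_subX 0); exists 0%N => /=;
  [exact: height_gt0|exact: base_level]. Qed.

Lemma T_neq_base x : X x -> T x <> a.
Proof.
rewrite {1}X_nontop => -[n _ [i /= ih xi]] Ta.
have [_] := T_level ih xi; rewrite Ta => aS.
by have := level_inj ih (height_gt0 n) aS (@base_level n).
Qed.

Hypothesis width_cvg0 : width (C n) @[n --> \oo] --> (0 : R).

(** It suffices to find a column in which y is not in level 0, and then to go down one level. Level
    0 of C_n is [a, a + width): it misses any y < a, and it misses y > a once the width is below y -
    a. *)
Lemma T_surj y : X y -> y <> a -> exists2 x, X x & T x = y.
Proof.
rewrite {1}XT.1 => -[n0 _ Cy] ya.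
have [ylt|aley] := ltP y a.
  have [i /= ih yi] := Cy.
  have i0 : i <> 0%N.
    by move=> i0; move: yi; rewrite i0 /level/= base_seq -/a => /andP[]; lra.
  exists (y + (left_end (C n0) i.-1 - left_end (C n0) i)).
    apply: (@support_subX n0); exists i.-1 => /=; first lia.
    by move: yi; rewrite /level/=; lra.
  rewrite (XT.2 n0 i.-1); [|lia|by move: yi; rewrite /level/=; lra].
  by rewrite prednK; [ring|lia].
have yagt0 : 0 < y - a by rewrite subr_gt0 lt_neqAle eq_sym aley andbT;
  apply/eqP.
have [N _ wN] := (cvgrPdist_lt _ _).1 width_cvg0 _ yagt0.
pose n := maxn N n0.
have /= := wN n (leq_maxl _ _);
  rewrite sub0r normrN gtr0_norm ?width_gt0// => wn.
have [i /= ih yi] := subset_support (leq_maxr N n0) Cy.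
have i0 : i <> 0%N.
  by move=> i0; move: yi; rewrite i0 /level/= base_seq -/a -/n => /andP[]; lra.
exists (y + (left_end (C n) i.-1 - left_end (C n) i)).
  apply: (@support_subX n); exists i.-1 => /=; first by rewrite /n; lia.
  by move: yi; rewrite /level/= -/n; lra.
rewrite (XT.2 n i.-1); [|by rewrite /n; lia|by move: yi; rewrite /level/= -/n;
  lra].
by rewrite prednK; [ring|lia].
Qed.

End dynamics.

End column_sequence_theory.

(** * Measurability, measure preservation and invertibility of T *)

Section translation.
Context {R : realType}.
Notation mu := (@lebesgue_measure R).
Implicit Types (A : set R) (c : R).

Lemma measurable_preimage_translate c A : measurable A ->
  measurable ((fun x => x + c) @^-1` A).
Proof.
move=> mA; rewrite -[X in measurable X]setTI.
by apply: (measurable_funD (@measurable_id _ _ _) (measurable_cst c)) => //.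
Qed.

Lemma lebesgue_measure_preimage_translate c A : measurable A ->
  mu ((fun x => x + c) @^-1` A) = mu A.
Proof.
move=> mA.
have mc : measurable_fun setT (fun x : measurableTypeR R => x + c :
  measurableTypeR R).
  exact: (measurable_funD (@measurable_id _ _ _) (measurable_cst c)).
pose nu := pushforward mu (fun x : measurableTypeR R => x + c : measurableTypeR
  R).
rewrite -[LHS]/(nu A); apply/esym.
have := @lebesgue_measure_unique R (nu : {measure set (measurableTypeR R) ->
  \bar R}).
apply => //= _ [[a b]] _ <-.
rewrite /nu /pushforward /=.
have -> : (fun x => x + c) @^-1` `]a, b]%classic = `]a - c, b - c]%classic.
  by apply/seteqP; split => x /=; rewrite !in_itv/= ltrBlDr lerBrDr.
by rewrite !lebesgue_measure_itv/= !lte_fin ltrD2r -!EFinD; case: ifP => // _;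
  congr EFin; ring.
Qed.

Lemma image_translate c A : (fun x => x + c) @` A = (fun x => x - c) @^-1` A.
Proof.
apply/seteqP; split=> [_ [x Ax <-]|x Ax] /=; first by rewrite addrK.
by exists (x - c) => //; rewrite subrK.
Qed.

Lemma measurable_translate c A : measurable A ->
  measurable ((fun x => x + c) @` A).
Proof. by move=> mA; rewrite image_translate;
  exact: measurable_preimage_translate. Qed.

Lemma lebesgue_measure_translate c A : measurable A ->
  mu ((fun x => x + c) @` A) = mu A.
Proof.
by move=> mA; rewrite image_translate;
  exact: lebesgue_measure_preimage_translate.
Qed.

End translation.

Lemma fine_measure_partition d (T : measurableType d) (R : realType)
    (mu : {measure set T -> \bar R}) (B : set T) (F : nat -> set T) H :
  measurable B -> (mu B < +oo)%E ->
  (forall i, (i < H)%N -> measurable (F i)) ->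
  trivIset [set i | (i < H)%N] F -> B `<=` \bigcup_(i in [set i | (i < H)%N]) F
    i ->
  fine (mu B) = \sum_(0 <= i < H) fine (mu (B `&` F i)).
Proof.
move=> mB Boo mF tF BF.
pose G i := if (i < H)%N then B `&` F i else set0.
have mG i : measurable (G i) by rewrite /G; case: ifP => // iH;
  apply: measurableI => //; exact: mF.
have -> : B = \big[setU/set0]_(i < H) G i.
  rewrite -bigcup_mkord; apply/seteqP; split=> [x Bx|x [i /= iH]].
    by have [i /= iH Fx] := BF _ Bx; exists i => //; rewrite /G iH.
  by rewrite /G iH => -[].
rewrite measure_bigsetU//; last first.
  apply/trivIsetP => i j _ _ ij; rewrite /G.
  case: ifP => iH; case: ifP => jH; rewrite ?set0I ?setI0//.
  rewrite setIACA setIid; move/trivIsetP : tF => /(_ i j iH jH ij) ->.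
  by rewrite setI0.
rewrite big_mkord -sum_fine; last first.
  move=> i _; rewrite ge0_fin_numE//; apply: le_lt_trans Boo;
    apply: le_measure; rewrite ?inE//.
  by rewrite /G; case: ifP => // _ x [].
apply: eq_bigr => i _; congr (fine (mu _)).
rewrite -bigcup_mkord; apply/seteqP; split=> [x|x [[j /= jH] ]].
  rewrite /G ltn_ord => -[Bx Fx]; split=> //; exists i => //=.
  by rewrite ltn_ord.
by rewrite /G jH ltn_ord => -[Bx Fjx] Fx.
Qed.

Section transformation.
Context {R : realType}.
Variables (k l m : nat -> nat) (C : nat -> column (R := R)).
Hypothesis kmlC : column_sequence k l m C.
Variables (X : set R) (T : R -> R).
Hypothesis XT : defined_by_columns C X T.
Notation mu := (@lebesgue_measure R).
Notation level n i := (level (C n) i).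

Lemma levelE n i :
  level n i = `[left_end (C n) i, left_end (C n) i + width (C n)[%classic.
Proof. by apply/seteqP; split=> x /=; rewrite in_itv. Qed.

Lemma measurable_level n i : measurable (level n i).
Proof. by rewrite levelE; exact: measurable_itv. Qed.

Lemma mu_level n i : mu (level n i) = (width (C n))%:E.
Proof.
rewrite levelE lebesgue_measure_itv/= lte_fin ltrDl (width_gt0 kmlC).
by rewrite -EFinB addrAC subrr add0r.
Qed.

Lemma measurable_support n : measurable (support (C n)).
Proof. by apply: bigcup_measurable => i _; exact: measurable_level. Qed.

Lemma measurable_nontop n : measurable (nontop C n).
Proof. by apply: bigcup_measurable => i _; exact: measurable_level. Qed.

Lemma measurable_X : measurable X.
Proof. by rewrite XT.1; apply: bigcup_measurable => n _;
  exact: measurable_support. Qed.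

Let shift n i j := left_end (C n) (i + j) - left_end (C n) i.

Lemma image_iter_level n i j B : (i + j < height (C n))%N ->
  iter j T @` (B `&` level n i) = (fun x => x + shift n i j) @` (B `&` level n
    i).
Proof.
move=> ij; apply/seteqP; split=> [_ [x [Bx xi] <-]|_ [x [Bx xi] <-]].
  by exists x => //; rewrite (iter_level XT ij xi).1.
by exists x => //; rewrite (iter_level XT ij xi).1.
Qed.

Lemma image_T_level n i B : (i.+1 < height (C n))%N ->
  T @` (B `&` level n i) = (fun x => x + shift n i 1) @` (B `&` level n i).
Proof. by move=> ih; rewrite -image_iter_level// addn1. Qed.

Let nontop_split n B : B `&` nontop C n =
  \bigcup_(i in [set i | (i.+1 < height (C n))%N]) (B `&` level n i).
Proof. by rewrite /nontop setI_bigcupr. Qed.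

Let measurable_image_nontop n B : measurable B ->
  measurable (T @` (B `&` nontop C n)) /\
  mu (T @` (B `&` nontop C n)) = mu (B `&` nontop C n).
Proof.
move=> mB; pose D := [set i | (i.+1 < height (C n))%N].
have E : T @` (B `&` nontop C n) = \bigcup_(i in D) T @` (B `&` level n i).
  by rewrite nontop_split image_bigcup.
have mi i : D i -> measurable (T @` (B `&` level n i)).
  move=> ih; rewrite image_T_level//; apply: measurable_translate.
  by apply: measurableI => //; exact: measurable_level.
split; first by rewrite E; exact: bigcup_measurable.
have ti : trivIset D (fun i => B `&` level n i).
  apply/trivIsetP => i j /= /ltnW ih /ltnW jh ij;
    rewrite -subset0 => x [[_ xi] [_ xj]].
  by rewrite (level_inj kmlC ih jh xi xj) eqxx in ij.
rewrite E nontop_split !measure_bigcup//.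
- apply: eq_eseriesr => i; rewrite inE => ih; rewrite image_T_level//.
  by apply: lebesgue_measure_translate; apply: measurableI => //;
    exact: measurable_level.
- by move=> i _; apply: measurableI => //; exact: measurable_level.
- apply/trivIsetP => i j /= ih jh ij;
    rewrite -subset0 => _ [[x [_ xi] <-] [y [_ yj] Tyx]].
  have [_ xS] := T_level XT ih xi; have [_ yS] := T_level XT jh yj.
  have [e] : i.+1 = j.+1 by apply: (level_inj kmlC ih jh xS); rewrite -Tyx.
  by rewrite e eqxx in ij.
Qed.

Let split_X B : B `<=` X -> B = \bigcup_n (B `&` nontop C n).
Proof.
by move=> BX; rewrite -setI_bigcupr -(X_nontop kmlC XT); apply/esym/setIidl.
Qed.

Lemma measurable_image_T B : measurable B -> B `<=` X -> measurable (T @` B).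
Proof.
move=> mB /split_X ->; rewrite image_bigcup; apply: bigcup_measurable => n _.
exact: (measurable_image_nontop n mB).1.
Qed.

(** The measure is preserved on each trace of B on [nontop C n]; continuity from below along these
    increasing sets gives B itself. *)
Lemma mu_image_T B : measurable B -> B `<=` X -> mu (T @` B) = mu B.
Proof.
move=> mB BX; pose F n := B `&` nontop C n.
have mF n : measurable (F n) by apply: measurableI => //;
  exact: measurable_nontop.
have homoF n n' : (n <= n')%N -> F n `<=` F n'.
  by move=> nn x [Bx /(nontop_homo kmlC nn)].
have cF : mu (F n) @[n --> \oo] --> mu (\bigcup_n F n).
  apply: nondecreasing_cvg_mu => //; first by apply: bigcup_measurable => n _;
    exact: mF.
  by move=> n n' /homoF/subsetPset.
have cTF : mu (T @` F n) @[n --> \oo] --> mu (\bigcup_n (T @` F n)).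
  apply: (@nondecreasing_cvg_mu _ _ _ mu (fun n => T @` F n)).
  - by move=> n; exact: (measurable_image_nontop n mB).1.
  - by apply: bigcup_measurable => n _; exact: (measurable_image_nontop n mB).1.
  - by move=> n n' /homoF FF; apply/subsetPset; exact: image_subset.
have e : (fun n => mu (T @` F n)) = (fun n => mu (F n)).
  by apply/funext => n; exact: (measurable_image_nontop n mB).2.
rewrite (split_X BX) image_bigcup; move: cTF; rewrite e => cTF.
exact: cvg_unique cTF cF.
Qed.

Lemma iter_subX j B : B `<=` X -> iter j T @` B `<=` X.
Proof. by move=> BX _ [x /BX Xx <-]; exact: (iter_stable kmlC XT). Qed.

Lemma image_iterS j (B : set R) : iter j.+1 T @` B = T @` (iter j T @` B).
Proof. by rewrite -image_comp. Qed.

Lemma measurable_image_iter j B : measurable B -> B `<=` X ->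
  measurable (iter j T @` B).
Proof.
move=> mB BX; elim: j => [|j IH]; first by rewrite image_id.
by rewrite image_iterS; apply: measurable_image_T => //; exact: iter_subX.
Qed.

Lemma mu_image_iter j B : measurable B -> B `<=` X -> mu (iter j T @` B) = mu B.
Proof.
move=> mB BX; elim: j => [|j IH]; first by rewrite image_id.
rewrite image_iterS mu_image_T//; first exact: measurable_image_iter.
exact: iter_subX.
Qed.

Lemma measurable_preimage_T A : measurable A -> measurable (X `&` T @^-1` A).
Proof.
move=> mA; rewrite (X_nontop kmlC XT) setI_bigcupl;
  apply: bigcup_measurable => n _.
rewrite /nontop setI_bigcupl; apply: bigcup_measurable => i /= ih.
rewrite (_ : _ `&` _ = level n i `&` (fun x => x + shift n i 1) @^-1` A).
  by apply: measurableI;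
    [exact: measurable_level|exact: measurable_preimage_translate].
apply/seteqP; split=> x [xi /= Ax]; split=> //=.
  by move: Ax; rewrite (T_level XT ih xi).1 /shift addn1.
by rewrite (T_level XT ih xi).1 -[i.+1]addn1.
Qed.

Lemma measurable_fun_T : measurable_fun X T.
Proof. by move=> _ A mA; exact: measurable_preimage_T. Qed.

Lemma measurable_preimage_iter j A : measurable A -> measurable (X `&` iter j T
  @^-1` A).
Proof.
elim: j A => [|j IH] A mA; first by apply: measurableI => //;
  exact: measurable_X.
rewrite (_ : _ `&` _ = X `&` iter j T @^-1` (X `&` T @^-1` A)).
  by apply: IH; exact: measurable_preimage_T.
apply/seteqP; split=> x [Xx]; first by split=> //; split=> //;
  exact: (iter_stable kmlC XT).
by move=> [_].
Qed.

Hypothesis width_cvg0 : width (C n) @[n --> \oo] --> (0 : R).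

(** T is an injection of X into itself that misses only the base point a. Removing the forward orbit
    of a, a countable and therefore null set, leaves an invariant set on which T is bijective. *)
Lemma invertible_measure_preserving_T : invertible_measure_preserving mu X T.
Proof.
split; [exact: measurable_X|exact: measurable_fun_T|].
pose a := left_end (C 0) 0; pose O := range (fun j => iter j T a).
have OX : O `<=` X by move=> _ [j _ <-];
  exact/(iter_stable kmlC XT)/(baseX kmlC XT).
have cO : countable O by exact: card_image_le.
have mO : measurable O.
  rewrite /O (_ : range _ = \bigcup_j [set iter j T a]).
    by apply: bigcup_measurable => j _; exact: measurable_set1.
  by apply/seteqP; split=> [_ [j _ <-]|_ [j _ ->]]; exists j.
have X0 x : (X `\` O) x -> (X `\` O) (T x).
  move=> [Xx Ox]; split; first exact: (T_stable kmlC XT).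
  move=> [[|j] _ /= e]; first exact: (T_neq_base kmlC XT Xx).
  apply: Ox; exists j => //; apply: (T_inj kmlC XT) => //.
  exact/(iter_stable kmlC XT)/(baseX kmlC XT).
have surj y : (X `\` O) y -> exists2 x, (X `\` O) x & T x = y.
  move=> [Xy Oy]; have [x Xx Txy] : exists2 x, X x & T x = y.
    by apply: (T_surj kmlC XT) => // ya; apply: Oy; exists 0%N.
  exists x => //; split=> // -[j _ jx]; apply: Oy; exists j.+1 => //=.
  by rewrite jx.
exists (X `\` O); split; [split|].
- exact: measurableD measurable_X mO.
- by move=> x [].
- rewrite setDD; apply: countable_lebesgue_measure0.
  exact: sub_countable (subset_card_le (@subIsetr _ _ _)) cO.
- split=> //.
    by move=> x y; rewrite !inE => -[Xx _] [Xy _]; exact: (T_inj kmlC XT).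
- move=> A mA AX0; have AX : A `<=` X by move=> x /AX0[].
  split; first exact: measurable_image_T.
  have mP : measurable ((X `\` O) `&` T @^-1` A).
    rewrite (_ : _ `&` _ = (X `\` O) `&` (X `&` T @^-1` A)).
      by apply: measurableI;
        [exact: measurableD measurable_X mO|exact: measurable_preimage_T].
    by apply/seteqP; split=> x [[Xx Ox]]; [move=> Tx|move=> [_ Tx]].
  have PX : (X `\` O) `&` T @^-1` A `<=` X by move=> x [[]].
  apply: (etrans (esym (mu_image_T mP PX))).
  congr (mu _); apply/seteqP; split=> [_ [x [_ Ax] <-]//|y Ay].
  by have [x Ox Txy] := surj _ (AX0 _ Ay); exists x => //; split=> //=;
    rewrite Txy.
Qed.

End transformation.

(** * Overlaps of subsets of the initial level *)

Lemma sum_shift_pair_sum (R : realFieldType) H r (g f : nat -> R) :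
  (forall x, (H <= x)%N -> f x = 0) ->
  \sum_(0 <= j < r) \sum_(0 <= d < H) g d * f (d + j)%N = pair_sum H r g f.
Proof.
move=> f0; rewrite pair_sum_rows// exchange_big/=; apply: eq_bigr => d _.
rewrite -mulr_sumr; congr (_ * _); rewrite /wsum addnC.
rewrite -{2}[d]add0n big_addn addnK.
by apply: eq_bigr => j _; rewrite addnC.
Qed.

Section overlaps.
Context {R : realType}.
Variables (k l m : nat -> nat) (C : nat -> column (R := R)).
Hypothesis kmlC : column_sequence k l m C.
Variables (X : set R) (T : R -> R).
Hypothesis XT : defined_by_columns C X T.
Notation mu := (@lebesgue_measure R).
Notation level n i := (level (C n) i).
Notation len A := (fine (mu A)).
Notation column_set n A := (column_function C n (\1_A : R -> R)).
Notation Phi := (overlap_sum mu T).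

Let F := support (C 0).

Lemma support0E : F = level 0 0.
Proof.
apply/seteqP; split=> [x [i /=]|x x0].
  by rewrite kmlC.1.2 ltnS leqn0 => /eqP->.
by exists 0%N => //=; rewrite kmlC.1.2.
Qed.

Lemma measurable_support0 : measurable F.
Proof. exact: measurable_support. Qed.

Lemma mu_support0 : mu F = 1%E.
Proof. by rewrite support0E (mu_level kmlC) kmlC.1.1. Qed.

Lemma support0_subX : F `<=` X.
Proof. exact: (support_subX XT). Qed.

Lemma column_set_support0 : column_set 0 F.
Proof. exact: (column_function_support kmlC). Qed.

Lemma mu_le1 B : measurable B -> B `<=` F -> (mu B <= 1)%E.
Proof. by move=> mB BF; rewrite -mu_support0; apply: le_measure;
  rewrite ?inE//; exact: measurable_support0. Qed.

Lemma mu_fin_num B : measurable B -> B `<=` F -> mu B \is a fin_num.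
Proof.
move=> mB BF; rewrite ge0_fin_numE//.
by apply: le_lt_trans (mu_le1 mB BF) _; rewrite ltry.
Qed.

Lemma len_le A B : measurable A -> measurable B -> A `<=` B -> B `<=` F -> len
  A <= len B.
Proof.
move=> mA mB AB BF; apply: fine_le; rewrite ?mu_fin_num//.
- exact: subset_trans BF.
- by apply: le_measure; rewrite ?inE.
Qed.

Lemma len_ge0 A : 0 <= len A.
Proof. exact: fine_ge0. Qed.

Lemma len_le1 B : measurable B -> B `<=` F -> len B <= 1.
Proof.
move=> mB BF; have <- : len F = 1 by rewrite mu_support0.
by apply: len_le => //; exact: measurable_support0.
Qed.

Section half_height.
Variables (n H : nat).
Hypothesis hH : height (C n.+1) = (2 * H)%N.

(* Cut off at H because [left_end] is the junk value 0 above the column. *)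
Definition level_lengths (B : set R) (y : nat) : R :=
  if (y < H)%N then len (B `&` level n.+1 y) else 0.

Let f_ A := nth 0 (values C n.+1 (\1_A : R -> R)).

Let F_cover : F `<=` \bigcup_(i in [set i | (i < H)%N]) level n.+1 i.
Proof.
move=> x Fx; have [i /= ih xi] := subset_support kmlC (leq0n n.+1) Fx.
exists i => //=; have := support_lower_half kmlC ih xi (subset_support kmlC
  (leq0n n) Fx).
by rewrite hH ltn_pmul2l.
Qed.

Let F_lower i x : (i < height (C n.+1))%N -> level n.+1 i x -> F x -> (i < H)%N.
Proof.
move=> ih xi Fx; have [j /= jH xj] := F_cover Fx.
by rewrite (level_inj kmlC ih _ xi xj)// hH; lia.
Qed.

Let lt_height i : (i < H)%N -> (i < height (C n.+1))%N.
Proof. by rewrite hH; lia. Qed.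

Lemma values_out A x : A `<=` F -> (H <= x)%N -> f_ A x = 0.
Proof.
move=> AF Hx; rewrite /f_; have [xh|hx] := ltnP x (height (C n.+1)); last first.
  by rewrite nth_default// size_values.
rewrite nth_values// indicE; case: (boolP (_ \in A)) => //;
  rewrite inE => /AF Fx.
suff : (x < H)%N by lia.
by apply: (F_lower xh _ Fx); rewrite /Defs.level/= lexx ltrDl (width_gt0 kmlC).
Qed.

Lemma values_set A i x : column_set n.+1 A -> (i < height (C n.+1))%N ->
  level n.+1 i x -> f_ A i = (x \in A)%:R.
Proof. by move=> cA ih xi; rewrite /f_ -(values_level cA ih xi) indicE. Qed.

Lemma level_lengths_out B x : (H <= x)%N -> level_lengths B x = 0.
Proof. by rewrite /level_lengths ltnNge => ->. Qed.

Let level_measurable i : measurable (level n.+1 i).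
Proof. exact: measurable_level. Qed.

Lemma sum_level_lengths B : measurable B -> B `<=` F ->
  wsum (level_lengths B) 0 H = len B.
Proof.
move=> mB BF; rewrite (@fine_measure_partition _ _ _ mu B (fun i => level n.+1
  i) H)//.
- by apply: eq_big_nat => i /andP[_ iH]; rewrite /level_lengths iH.
- by rewrite -ge0_fin_numE// mu_fin_num.
- by move=> i _; exact: level_measurable.
- move=> i j /= iH jH [x [xi xj]].
  exact: (level_inj kmlC (lt_height iH) (lt_height jH) xi xj).
- exact: subset_trans F_cover.
Qed.

Let in_level i : level n.+1 i (left_end (C n.+1) i).
Proof. by rewrite /Defs.level/= lexx ltrDl (width_gt0 kmlC). Qed.

(** Supplies the domination e <= w u of the uniform bounds: a level that meets B lies in F, so the
    indicator of F is 1 there. *)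
Lemma level_lengths_le B x : measurable B -> B `<=` F ->
  0 <= level_lengths B x <= width (C n.+1) * f_ F x.
Proof.
move=> mB BF; rewrite /level_lengths; have [xH|Hx] := ltnP x H; last first.
  by rewrite values_out ?mulr0 ?lexx.
rewrite len_ge0/=.
have cF := column_function_le kmlC (leq0n n.+1) column_set_support0.
case: (pselect (B `&` level n.+1 x = set0)) => [->|/eqP/set0P[y [By xy]]].
  rewrite measure0/= mulr_ge0//; first exact/ltW/(width_gt0 kmlC).
  by apply: nth_ge0 => z /mapP[? _ ->]; rewrite indicE.
rewrite (values_set cF (lt_height xH) xy) mem_set ?mulr1; last exact: BF.
rewrite -[leRHS]/(fine (width (C n.+1))%:E) -(mu_level kmlC n.+1 x).
have mBx : measurable (B `&` level n.+1 x) by apply: measurableI.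
apply: fine_le; first by apply: mu_fin_num => // z [/BF].
  by rewrite (mu_level kmlC).
by apply: le_measure; rewrite ?inE //; exact: level_measurable.
Qed.

Variable r : nat.
Hypothesis rH : (r <= H)%N.

(** The overlap is pulled back to the points of B that T^j sends into A and split over departure
    levels d: level d + j lies in A or misses it, so all or nothing of B in level d counts. *)
Lemma overlap_rows A B : measurable A -> measurable B -> A `<=` F -> B `<=` F ->
  column_set n.+1 A -> Phi A B r = pair_sum H r (level_lengths B) (f_ A).
Proof.
move=> mA mB AF BF cA; rewrite -sum_shift_pair_sum; last first.
  by move=> x; exact: values_out.
rewrite /overlap_sum !big_nat; apply: eq_bigr => j /andP[_ jr].
have BX := subset_trans BF support0_subX.
pose B' := B `&` (X `&` iter j T @^-1` A).
have mB' : measurable B'.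
  by apply: measurableI => //; exact: (measurable_preimage_iter kmlC XT).
have B'X : B' `<=` X by move=> x [/BX].
have -> : A `&` iter j T @` B = iter j T @` B'.
  apply/seteqP; split=> [x [Ax [y By yx]]|x [y [By [Xy Ay]] yx]].
    by exists y => //; split=> //; split; [exact: BX|rewrite /= yx].
  by split; [rewrite -yx|exists y].
transitivity (len B'); first by congr (fine _); exact: (mu_image_iter kmlC XT).
have B'F : B' `<=` F by move=> x [/BF].
rewrite -sum_level_lengths//; apply: eq_big_nat => d /andP[_ dH].
rewrite /level_lengths dH.
(* Both d and j are below H, so the orbit segment does not leave the column. *)
have djh : (d + j < height (C n.+1))%N by rewrite hH; lia.
have Tj x : level n.+1 d x -> f_ A (d + j) = (iter j T x \in A)%:R.
  by move=> xd; apply: (values_set cA djh); exact: (iter_level XT djh xd).2.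
have := Tj _ (in_level d); case: (boolP (_ \in A)) => [Ad|Ad] e; rewrite e.
  rewrite mulr1; congr (fine (mu _)); apply/seteqP; split=> x [Bx xd].
    by case: Bx.
  split=> //; split=> //; split; first exact: BX.
  have := Tj _ xd; rewrite e => /esym/eqP; case: (boolP (_ \in A));
    first by rewrite inE.
  by rewrite eq_sym oner_eq0.
rewrite mulr0 (_ : _ `&` _ = set0) ?measure0//;
  rewrite -subset0 => x [[_ [_ Ax]] xd].
have := Tj _ xd; rewrite e mem_set// => /eqP; by rewrite eq_sym oner_eq0.
Qed.

(** Now B is a union of levels, and the overlap is split over arrival levels d + j: such a level
    lies in T^j B or misses it according to level d. *)
Lemma overlap_cols A B : measurable A -> measurable B -> A `<=` F -> B `<=` F ->
  column_set n.+1 B -> Phi A B r = pair_sum H r (f_ B) (level_lengths A).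
Proof.
move=> mA mB AF BF cB; rewrite -sum_shift_pair_sum;
  last exact: level_lengths_out.
rewrite /overlap_sum !big_nat; apply: eq_bigr => j /andP[_ jr].
have BX := subset_trans BF support0_subX.
have djh d : (d < H)%N -> (d + j < height (C n.+1))%N by rewrite hH; lia.
have mA' : measurable (A `&` iter j T @` B).
  by apply: measurableI => //; exact: (measurable_image_iter kmlC XT).
rewrite (@fine_measure_partition _ _ _ mu _ (fun i => level n.+1 (i + j)) H)//;
  first last.
- move=> x [_ [y By <-]]; have [d /= dH yd] := F_cover (BF _ By).
  by exists d => //; exact: (iter_level XT (djh d dH) yd).2.
- move=> i i' /= iH iH' [x [xi xi']].
  by apply: (@addIn j); exact: (level_inj kmlC (djh _ iH) (djh _ iH') xi xi').
- by move=> i _; exact: level_measurable.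
- by rewrite -ge0_fin_numE// mu_fin_num// => x [/AF].
apply: eq_big_nat => d /andP[_ dH].
(* For d + j >= H the cut-off value 0 is correct, because A lies in F and F in the lower half. *)
have lenA : len (A `&` level n.+1 (d + j)) = level_lengths A (d + j).
  rewrite /level_lengths; case: ifP => // djH.
  rewrite (_ : _ `&` _ = set0) ?measure0//; rewrite -subset0 => x [/AF Fx xdj].
  by rewrite (F_lower (djh d dH) xdj Fx) in djH.
have fB y : level n.+1 d y -> f_ B d = (y \in B)%:R.
  by move=> yd; apply: (values_set cB (lt_height dH)).
have := fB _ (in_level d); case: (boolP (_ \in B)) => [Bd|Bd] e; rewrite e.
  rewrite mul1r -lenA; congr (fine (mu _)); apply/seteqP; split=> x [Ax xd].
    by case: Ax.
  split=> //; split=> //.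
  pose y := x - (left_end (C n.+1) (d + j) - left_end (C n.+1) d).
  have yd : level n.+1 d y by move: xd; rewrite /Defs.level/= /y; lra.
  exists y; last by rewrite (iter_level XT (djh d dH) yd).1 /y subrK.
  have := fB _ yd; rewrite e => /esym/eqP; case: (boolP (_ \in B));
    first by rewrite inE.
  by rewrite eq_sym oner_eq0.
rewrite mul0r (_ : _ `&` _ = set0) ?measure0//; rewrite -subset0.
move=> x [[_ [y By yx]] xdj]; have [d' /= dH' yd] := F_cover (BF _ By).
have := (iter_level XT (djh d' dH') yd).2; rewrite yx => xdj'.
have /addIn e' := level_inj kmlC (djh _ dH) (djh _ dH') xdj xdj'.
have := fB y; rewrite e' => /(_ yd); rewrite -e' e mem_set// => /eqP.
by rewrite eq_sym oner_eq0.
Qed.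

End half_height.

End overlaps.

(** * Bounded deviations and the uniform upper bound *)

Section uniform_estimates.
Context {R : realType}.
Variables (k l m : nat -> nat) (C : nat -> column (R := R)).
Hypothesis kmlC : column_sequence k l m C.
Variables (X : set R) (T : R -> R).
Hypothesis XT : defined_by_columns C X T.
Notation mu := (@lebesgue_measure R).
Notation len A := (fine (mu A)).
Notation column_set n A := (column_function C n (\1_A : R -> R)).
Notation Phi := (overlap_sum mu T).
Let F := support (C 0).
Let FX : F `<=` X := support0_subX XT.
Let mF : measurable F. Proof. exact: measurable_support0. Qed.

(** Width times total is the integral of f, to which the new spacers add nothing. *)
Lemma total_values_succ n f : column_function C n f ->
  width (C n.+1) * total (values C n.+1 f) = width (C n) * total (values C n f).
Proof.
move=> fn; rewrite (values_succ kmlC fn) total_next_list (width_succ kmlC).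
have [k0 m0 _] := kmlC.2 n; rewrite prednK// (mulnC (m n)).
rewrite mulrA mulrVK// unitfE pnatr_eq0 -lt0n muln_gt0 k0; exact: m0.
Qed.

Lemma total_values_le n n' f : (n <= n')%N -> column_function C n f ->
  width (C n') * total (values C n' f) = width (C n) * total (values C n f).
Proof.
move=> nn fn; elim: n' nn => [|n' IH]; first by rewrite leqn0 => /eqP->.
rewrite leq_eqVlt => /predU1P[->//|]; rewrite ltnS => nn.
rewrite total_values_succ ?IH//; exact: (column_function_le kmlC nn fn).
Qed.

Lemma column_set_support0_le n : column_set n F.
Proof. exact: (column_function_le kmlC (leq0n n) (column_set_support0 kmlC)).
  Qed.

Lemma total_values_support0 n : width (C n) * total (values C n (\1_F : R ->
  R)) = 1.
Proof.
rewrite (total_values_le (leq0n n) (column_set_support0 kmlC)) kmlC.1.1 mul1r.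
have : size (values C 0 (\1_F : R -> R)) = 1%N by rewrite size_values kmlC.1.2.
have := nth_values (\1_F : R -> R) (height_gt0 kmlC 0).
case: (values C 0 _) => [|a []]//= -> _;
  rewrite /total big_seq1 indicE mem_set//.
exists 0%N; first exact: (height_gt0 kmlC 0).
by rewrite /= /level/= lexx ltrDl (width_gt0 kmlC).
Qed.

Lemma half_heightP n : {H | height (C n.+1) = (2 * H)%N}.
Proof. by eexists; exact: (height_succ kmlC n). Qed.

Lemma heightS_ge n : (2 * height (C n) <= height (C n.+1))%N.
Proof.
rewrite (height_succ kmlC) leq_mul2l/= (leq_trans _ (leq_addl _ _))//.
by have [_ m0 _] := kmlC.2 n; rewrite leq_pmull.
Qed.

Lemma height_ge n : (n < height (C n))%N.
Proof.
elim: n => [|n IH]; first exact: (height_gt0 kmlC).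
by apply: (leq_trans _ (heightS_ge n)); lia.
Qed.

Lemma large_half_height n0 r : exists n H,
  [/\ (n0 <= n)%N, height (C n.+1) = (2 * H)%N & (r <= H)%N].
Proof.
pose n := maxn n0 r; have [H hH] := half_heightP n.
exists n, H; split=> //; first exact: leq_maxl.
have := heightS_ge n; rewrite hH leq_mul2l/= => nH.
by apply: (leq_trans _ (leq_trans (ltnW (height_ge n)) nH)); exact: leq_maxr.
Qed.

Lemma level_lengths_column_set n H A x : height (C n.+1) = (2 * H)%N ->
  column_set n.+1 A -> A `<=` F -> level_lengths C n H A x =
  width (C n.+1) * nth 0 (values C n.+1 (\1_A : R -> R)) x.
Proof.
move=> hH cA AF; rewrite /level_lengths; have [xH|Hx] := ltnP x H; last first.
  by rewrite (values_out kmlC hH AF Hx) mulr0.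
have xh : (x < height (C n.+1))%N by rewrite hH; lia.
have Ax y : level (C n.+1) x y -> _ := values_set cA xh.
have xx : level (C n.+1) x (left_end (C n.+1) x).
  by rewrite /level/= lexx ltrDl (width_gt0 kmlC).
have := Ax _ xx; case: (boolP (_ \in A)) => Aj e; rewrite e.
  rewrite mulr1 (_ : A `&` _ = level (C n.+1) x) ?(mu_level kmlC)//.
  apply/setIidr => y xy; have := Ax _ xy; rewrite e => /esym/eqP.
  by case: (boolP (y \in A)); [rewrite inE|rewrite eq_sym oner_eq0].
rewrite mulr0 (_ : A `&` _ = set0) ?measure0//; rewrite -subset0 => y [Ay xy].
by have := Ax _ xy; rewrite e mem_set// => /eqP; rewrite eq_sym oner_eq0.
Qed.

Lemma total_column_set n A : column_set n A -> measurable A -> A `<=` F ->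
  width (C n) * total (values C n (\1_A : R -> R)) = len A.
Proof.
move=> cA mA AF; have [H hH] := half_heightP n.
rewrite -(total_values_le (leqnSn n) cA).
have cA' := column_function_le kmlC (leqnSn n) cA.
rewrite -(sum_level_lengths kmlC hH)//.
rewrite -(wsum_nth_total (x := height (C n.+1))); last by rewrite size_values.
rewrite (@wsum_widenr _ _ 0 H (height (C n.+1))); first last.
- by rewrite hH; lia.
- by move=> x Hx; exact: (values_out kmlC hH AF Hx).
rewrite /wsum mulr_sumr; apply: eq_bigr => i _.
by rewrite (level_lengths_column_set _ hH).
Qed.

Lemma column_functionB n f g c : column_function C n f -> column_function C n g
  ->
  column_function C n (fun x => f x + c * g x).
Proof.
move=> [fC f0] [gC g0]; split=> [a x aC ax|x Cx];
  first by rewrite (fC a x)// (gC a x).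
by rewrite f0// g0// mulr0 addr0.
Qed.

Lemma balanced_total_norm (s : seq R) : total s = 0 ->
  balanced (\sum_(z <- s) `|z|) s.
Proof.
move=> s0; split=> // x; apply: (le_trans (ler_norm_sum _ _ _)).
rewrite -[in leRHS](cat_take_drop x s) big_cat/= lerDl.
by apply: sumr_ge0 => z _.
Qed.

Lemma balanced_values n n' f K : (n <= n')%N -> column_function C n f ->
  balanced K (values C n f) -> balanced K (values C n' f).
Proof.
move=> nn fn fK; elim: n' nn => [|n' IH]; first by rewrite leqn0 => /eqP<-.
rewrite leq_eqVlt => /predU1P[<-//|]; rewrite ltnS => nn.
rewrite (values_succ kmlC); last exact: (column_function_le kmlC nn fn).
exact: balanced_next_list (IH nn).
Qed.

Lemma total_valuesD n f g c : total (values C n (fun x => f x + c * g x)) =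
  total (values C n f) + c * total (values C n g).
Proof. by rewrite /total !big_map mulr_sumr -big_split. Qed.

Lemma nth_valuesD n f g c i : nth 0 (values C n (fun x => f x + c * g x)) i =
  nth 0 (values C n f) i + c * nth 0 (values C n g) i.
Proof.
have [ih|hi] := ltnP i (height (C n)); first by rewrite !nth_values.
by rewrite !nth_default ?size_values// mulr0 addr0.
Qed.

(* On every copy of C_n the function 1_A - mu(A) 1_F sums to zero, so its
   partial sums along a later column stay bounded. *)
Lemma deviation_bound n A : column_set n A -> measurable A -> A `<=` F ->
  exists2 K, 0 <= K & forall n', (n <= n')%N -> forall x,
    `|wsum (fun i => nth 0 (values C n' (\1_A : R -> R)) i +
       (- len A) * nth 0 (values C n' (\1_F : R -> R)) i) 0 x| <= K.
Proof.
move=> cA mA AF; pose f x : R := \1_A x + (- len A) * \1_F x.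
have fn : column_function C n f.
  by apply: column_functionB => //; exact: column_set_support0_le.
have f0 : total (values C n f) = 0.
  apply: (mulfI (lt0r_neq0 (width_gt0 kmlC n))).
  rewrite total_valuesD mulrDr total_column_set// mulr0 mulrCA
    total_values_support0; ring.
have fK := balanced_total_norm f0.
exists (\sum_(z <- values C n f) `|z|); first exact: balanced_ge0 fK.
move=> n' nn x; have [_ /(_ x)] := balanced_values nn fn fK.
rewrite -wsum_nth; congr (`|_| <= _); apply: eq_bigr => i _; exact: nth_valuesD.
Qed.

(** K must not depend on r, although the column in which the overlap is computed does:
    [deviation_bound] serves all later columns at once, and mu(B) <= 1 removes B. *)
Lemma overlap_rows_deviation n A : column_set n A -> measurable A -> A `<=` F ->
  exists K, forall B r, measurable B -> B `<=` F ->
    `|Phi A B r - len A * Phi F B r| <= K.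
Proof.
move=> cA mA AF; have [K K0 HK] := deviation_bound cA mA AF.
exists (K *+ 2) => B r mB BF.
have [n' [H [nn hH rH]]] := large_half_height n r.
have nn' : (n <= n'.+1)%N := leqW nn.
have cA' := column_function_le kmlC nn' cA.
have e0 x : 0 <= level_lengths C n' H B x.
  by case/andP: (level_lengths_le kmlC hH x mB BF).
rewrite (overlap_rows kmlC XT hH rH mA mB AF BF cA').
rewrite (overlap_rows kmlC XT hH rH mF mB (@subset_refl _ F) BF
  (column_set_support0_le _)).
rewrite -mulNr -pair_sumZr -pair_sumDr.
apply: (le_trans (@normr_pair_sum_rows _ H r _ _ K e0 _ (HK _ nn'))).
  move=> x Hx; rewrite (values_out kmlC hH AF Hx).
  by rewrite (values_out kmlC hH (@subset_refl _ F) Hx) mulr0 addr0.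
rewrite (sum_level_lengths kmlC hH)// -[leRHS]mulr1 ler_wpM2l ?mulrn_wge0//.
exact: (len_le1 kmlC).
Qed.

Lemma overlap_cols_deviation n B : column_set n B -> measurable B -> B `<=` F ->
  exists K, forall A r, measurable A -> A `<=` F ->
    `|Phi A B r - len B * Phi A F r| <= K.
Proof.
move=> cB mB BF; have [K K0 HK] := deviation_bound cB mB BF.
exists (K *+ 2) => A r mA AF.
have [n' [H [nn hH rH]]] := large_half_height n r.
have nn' : (n <= n'.+1)%N := leqW nn.
have cB' := column_function_le kmlC nn' cB.
have e0 x : 0 <= level_lengths C n' H A x.
  by case/andP: (level_lengths_le kmlC hH x mA AF).
rewrite (overlap_cols kmlC XT hH rH mA mB AF BF cB').
rewrite (overlap_cols kmlC XT hH rH mA mF AF (@subset_refl _ F)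
  (column_set_support0_le _)).
rewrite -mulNr -pair_sumZl -pair_sumDl.
apply: (le_trans (@normr_pair_sum_cols _ H r _ _ K e0 (HK _ nn'))).
rewrite (sum_level_lengths kmlC hH)// -[leRHS]mulr1 ler_wpM2l ?mulrn_wge0//.
exact: (len_le1 kmlC).
Qed.

Section linear_spacers.
Variable L : nat -> nat.
Hypothesis kE : forall n, k n = n.+1.
Hypothesis lE : forall n, l n = (L n * height (C n))%N.

Variables (n : nat) (h0 H r : nat).
Hypothesis n_gt0 : (0 < n)%N.
Hypothesis h0E : height (C n) = (2 * h0)%N.
Hypothesis hH : height (C n.+1) = (2 * H)%N.
Hypothesis h0r : (h0 <= r)%N.
Hypothesis rH : (r <= H)%N.

Let s := values C n (\1_F : R -> R).
Let w := width (C n.+1).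
Let u := nth 0 (values C n.+1 (\1_F : R -> R)).

Let s_ge0 z : z \in s -> 0 <= z.
Proof. by move=> /mapP[a _ ->]; rewrite indicE. Qed.

Let s_top i : (h0 <= i)%N -> nth 0 s i = 0.
Proof.
move=> hi; have := @values_top _ _ _ _ _ kmlC n.-1 (\1_F) i
  (column_set_support0_le _).
by rewrite prednK// h0E leq_mul2l/=; apply.
Qed.

Let m_gt0 : (0 < m n)%N. Proof. by have [] := kmlC.2 n. Qed.

Let sE : size s = height (C n). Proof. exact: size_values. Qed.

Let uE : u = nth 0 (next_list s (l n) n (m n)).
Proof. by rewrite /u (values_succ kmlC (column_set_support0_le n)) kE. Qed.

Let HE : H = (m n * n * size (s ++ nseq (l n) 0%R) + m n * size s)%N.
Proof.
apply/eqP; rewrite -(eqn_pmul2l (isT : (0 < 2)%N)) -hH (height_succ kmlC) kE/=.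
by rewrite size_cat size_nseq sE mulnAC.
Qed.

(** The left side is the measure of F inside the dense part, which is one of n + 1 subcolumns of
    equal width. *)
Let wq : w * ((m n)%:R * total s) = n.+1%:R^-1.
Proof.
have := total_values_support0 n; rewrite -/s /w (width_succ kmlC) kE natrM.
move: (width _) (total s) => x y xy.
have m0 : (m n)%:R != 0 :> R by rewrite pnatr_eq0 -lt0n.
have n0 : n.+1%:R != 0 :> R by rewrite pnatr_eq0.
move: n.+1%:R (m n)%:R m0 n0 => p p' p'0 p0.
by transitivity (x * y / p); [field; rewrite p0 p'0|rewrite xy mul1r].
Qed.

Let w_ge0 : 0 <= w. Proof. exact/ltW/(width_gt0 kmlC). Qed.

Let PhiFF : Phi F F r = w * pair_sum H r u u.
Proof.
rewrite (overlap_rows kmlC XT hH rH mF mF (@subset_refl _ F) (@subset_refl _ F)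
  (column_set_support0_le _)).
rewrite -pair_sumZl; congr pair_sum.
by apply/funext => x; rewrite (level_lengths_column_set _ hH)//;
  exact: column_set_support0_le.
Qed.

Let n_half : n.+1%:R <= 2 * n%:R :> R.
Proof. by rewrite -natrM ler_nat mul2n -addnn -addn1 leq_add2l. Qed.

(** Passes from counts to measures by the factor w. The share n / (n + 1) of the sparse part costs
    at most 2, which turns 8 into 16. *)
Let rescale (a E : R) : 0 <= a -> 0 <= E ->
  (m n * n)%:R * total s * a <=
    8 * (E + w * ((L n).+2 * m n)%:R * total s) * pair_sum H r u u ->
  a <= 16 * (E + (L n).+2%:R / n.+1%:R) * Phi F F r.
Proof.
move=> a0 E0 /(ler_wpM2l w_ge0) le; rewrite PhiFF.
have n1 : 0 < n.+1%:R :> R by rewrite ltr0n.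
have wq' := wq; rewrite -(ler_pM2l n1).
have e1 : w * ((m n * n)%:R * total s * a) = n.+1%:R^-1 * (n%:R * a).
  by rewrite -wq' natrM; ring.
have e2 : w * ((L n).+2 * m n)%:R * total s = (L n).+2%:R / n.+1%:R.
  by rewrite -wq' natrM; ring.
move: le; rewrite e1 e2 [leRHS]mulrCA ler_pdivrMl// => le.
apply: (@le_trans _ _ (2 * (n%:R * a))); first by rewrite mulrA ler_wpM2r.
apply: (le_trans (ler_wpM2l _ le)) => //.
by rewrite le_eqVlt; apply/orP; left; apply/eqP; ring.
Qed.

Let h0_le : (h0 <= size s)%N. Proof. by rewrite sE h0E mul2n -addnn leq_addl.
  Qed.

Let s_gt0 : (0 < size s)%N. Proof. by rewrite sE (height_gt0 kmlC). Qed.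

Let lE' : l n = (L n * size s)%N. Proof. by rewrite lE sE. Qed.

Lemma overlap_uniform E : measurable E -> E `<=` F ->
  Phi F E r <= 16 * (len E + (L n).+2%:R / n.+1%:R) * Phi F F r /\
  Phi E F r <= 16 * (len E + (L n).+2%:R / n.+1%:R) * Phi F F r.
Proof.
move=> mE EF.
have eu x : 0 <= level_lengths C n H E x <= w * nth 0 (next_list s (l n) n (m
  n)) x.
  by have := level_lengths_le kmlC hH x mE EF; rewrite -/u uE.
have e0 x : 0 <= level_lengths C n H E x by case/andP: (eu x).
have u0 x : 0 <= u x.
  by apply: nth_ge0 => z /mapP[a _ ->]; rewrite indicE.
split; apply: rescale; rewrite ?len_ge0//.
- by apply: sumr_ge0 => j _; exact: len_ge0.
- rewrite (overlap_rows kmlC XT hH rH mF mE (@subset_refl _ F) EF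
    (column_set_support0_le _)) -/u.
  rewrite -(sum_level_lengths kmlC hH mE EF) uE HE.
  have := pair_sum_rows_uniform s_ge0 s_top h0_le s_gt0 lE' n_gt0 m_gt0 h0r
    w_ge0 eu.
  by rewrite -HE.
- by apply: sumr_ge0 => j _; exact: len_ge0.
- rewrite (overlap_cols kmlC XT hH rH mE mF EF (@subset_refl _ F)
    (column_set_support0_le _)) -/u.
  rewrite -(sum_level_lengths kmlC hH mE EF) uE HE.
  have := pair_sum_cols_uniform s_ge0 s_top h0_le s_gt0 lE' n_gt0 m_gt0 h0r
    w_ge0 eu.
  by rewrite -HE.
Qed.

(** [pair_sum_ge] with t >= 1, and again n + 1 <= 2 n. The left side is the number of levels of C_n
    in F, the inverse of the width, so a_r tends to infinity. *)
Lemma return_sum_ge : total s <= 8 * Phi F F r.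
Proof.
have := pair_sum_ge s_ge0 s_top h0_le s_gt0 lE' n_gt0 m_gt0 h0r.
rewrite -HE -uE => ge.
have q0 : 0 <= total s by rewrite /total big_seq; apply: sumr_ge0 => z;
  exact: s_ge0.
have {}ge : (m n * n)%:R * total s ^+ 2 <= 4 * pair_sum H r u u.
  apply: le_trans ge; rewrite ler_wpM2r ?sqr_ge0// ler_nat leq_pmulr//.
  by rewrite leq_min muln_gt0 m_gt0 n_gt0.
have n1 : 0 < n.+1%:R :> R by rewrite ltr0n.
move: (ler_wpM2l w_ge0 ge); rewrite [leRHS]mulrCA -PhiFF.
have -> : w * ((m n * n)%:R * total s ^+ 2) = n.+1%:R^-1 * (n%:R * total s).
  by rewrite -wq natrM; ring.
rewrite ler_pdivrMl// => le; rewrite -(ler_pM2l n1).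
apply: (@le_trans _ _ (2 * (n%:R * total s))); first by rewrite mulrA ler_wpM2r.
apply: (le_trans (ler_wpM2l _ le)) => //.
by rewrite le_eqVlt; apply/orP; left; apply/eqP; ring.
Qed.

End linear_spacers.

End uniform_estimates.

(** * Asymptotic bounds for large times *)

Section limits.
Context {R : realType}.
Variables (k l m : nat -> nat) (C : nat -> column (R := R)).
Hypothesis kmlC : column_sequence k l m C.
Variables (X : set R) (T : R -> R).
Hypothesis XT : defined_by_columns C X T.
Variable L : nat -> nat.
Hypothesis kE : forall n, k n = n.+1.
Hypothesis lE : forall n, l n = (L n * height (C n))%N.
Hypothesis L_cvg0 : forall e : R, 0 < e ->
  exists n0, forall n, (n0 <= n)%N -> (L n).+2%:R / n.+1%:R <= e.
Notation mu := (@lebesgue_measure R).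
Notation len A := (fine (mu A)).
Notation column_set n A := (column_function C n (\1_A : R -> R)).
Notation Phi := (overlap_sum mu T).
Let F := support (C 0).
Let FX : F `<=` X := support0_subX XT.
Let mF : measurable F. Proof. exact: measurable_support0. Qed.

Lemma width_le n : n%:R * width (C n) <= 1.
Proof.
have w1 n' : width (C n') <= 1.
  elim: n' => [|n' IH]; first by rewrite kmlC.1.1.
  rewrite (width_succ kmlC) ler_pdivrMr ?mul1r; last first.
    by have [k0 m0 _] := kmlC.2 n'; rewrite ltr0n muln_gt0 k0.
  apply: (le_trans IH); rewrite ler1n muln_gt0.
  by have [-> ->] := kmlC.2 n'.
case: n => [|n]; first by rewrite mul0r.
rewrite (width_succ kmlC) kE mulrA ler_pdivrMr; last first.
  by have [k0 m0 _] := kmlC.2 n; rewrite ltr0n muln_gt0 m0.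
rewrite mul1r natrM ler_wpM2l// (le_trans (w1 n))// ler1n.
by have [_ ->] := kmlC.2 n.
Qed.

Lemma width_small (e : R) : 0 < e ->
  exists n0, forall n, (n0 <= n)%N -> width (C n) < e.
Proof.
move=> e0; exists (Num.truncn e^-1).+1 => n nn.
have n0 : 0 < n%:R :> R by rewrite ltr0n (leq_trans _ nn).
rewrite -(ltr_pM2l n0); apply: le_lt_trans (width_le n) _.
rewrite -ltr_pdivrMr// mul1r; apply: lt_le_trans (truncnS_gt _) _.
by rewrite ler_nat.
Qed.

Lemma width_cvg0 : width (C n) @[n --> \oo] --> (0 : R).
Proof.
apply/cvgrPdist_lt => e /width_small[n0 n0P]; exists n0 => //= n /n0P we.
by rewrite sub0r normrN gtr0_norm// (width_gt0 kmlC).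
Qed.

Lemma half_height_bracket n0 r : (0 < n0)%N -> (height (C n0) <= 2 * r)%N ->
  exists n h0 H, [/\ (n0 <= n)%N, height (C n) = (2 * h0)%N,
    height (C n.+1) = (2 * H)%N & (h0 <= r <= H)%N].
Proof.
move=> n0_gt0 n0r.
have ex : exists j, (2 * r <= height (C (n0 + j).+1))%N.
  exists r; apply: (leq_trans _ (heightS_ge kmlC _)); rewrite leq_mul2l/=.
  by apply: (leq_trans _ (ltnW (height_ge kmlC _))); exact: leq_addl.
case: (ex_minnP ex) => j rj jmin.
(* Only a successor column has even height by construction (C_0 has height 1), whence the
   requirement 0 < n0. *)
have [h0 h0E] := half_heightP kmlC (n0 + j).-1.
have [H HE] := half_heightP kmlC (n0 + j).
rewrite prednK in h0E; last by rewrite addn_gt0 n0_gt0.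
exists (n0 + j)%N, h0, H; split=> //; first exact: leq_addr.
move: rj; rewrite HE leq_mul2l/= => ->; rewrite andbT.
rewrite -(leq_pmul2l (isT : 0 < 2)%N) -h0E.
case: j jmin {h0E HE} => [|j] jmin; first by rewrite addn0.
rewrite leqNgt; apply/negP => lt; suff : (j.+1 <= j)%N by rewrite ltnn.
by apply: jmin; rewrite addnS in lt; exact: ltnW.
Qed.

Lemma eventually_uniform (e : R) : 0 < e -> exists r0, forall r, (r0 <= r)%N ->
  forall E, measurable E -> E `<=` F ->
  Phi F E r <= (16 * len E + e) * Phi F F r /\
  Phi E F r <= (16 * len E + e) * Phi F F r.
Proof.
move=> e0; have e16 : 0 < e / 16 by rewrite divr_gt0.
have [n0 n0P] := L_cvg0 e16; exists (height (C n0.+1)) => r r0 E mE EF.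
have r2 : (height (C n0.+1) <= 2 * r)%N by lia.
have [n [h0 [H [nn h0E HE /andP[h0r rH]]]]] := half_height_bracket (ltn0Sn _)
  r2.
have [|le1 le2] := overlap_uniform kmlC XT kE lE _ h0E HE h0r rH mE EF.
  by apply: leq_trans nn.
have le : 16 * (len E + (L n).+2%:R / n.+1%:R) * Phi F F r <= (16 * len E + e)
  * Phi F F r.
  rewrite ler_wpM2r//; first by apply: sumr_ge0 => j _; exact: len_ge0.
  by have := n0P n (ltnW nn); move: (_ / n.+1%:R) => y; lra.
by split; [exact: le_trans le1 le|exact: le_trans le2 le].
Qed.

Lemma eventually_return_ge (M : R) :
  exists r0, forall r, (r0 <= r)%N -> M <= Phi F F r.
Proof.
pose n0 := (Num.truncn (8 * M)).+1; exists (height (C n0)) => r r0.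
have r2 : (height (C n0) <= 2 * r)%N by lia.
have [n [h0 [H [nn h0E HE /andP[h0r rH]]]]] := half_height_bracket (ltn0Sn _)
  r2.
have := return_sum_ge kmlC XT kE lE (leq_trans (ltn0Sn _) nn) h0E HE h0r rH.
have w0 := width_gt0 kmlC n.
have := total_values_support0 kmlC n; have := width_le n.
set t := total _; set P := Phi _ _ _ => nw wt tP.
have nt : n%:R <= t by rewrite -(ler_pM2l w0) wt mulrC.
have : 8 * M <= n%:R.
  by apply: (le_trans (ltW (truncnS_gt _))); rewrite ler_nat.
lra.
Qed.

(** The cost of replacing A by A' is an overlap with the whole of F, the form that
    [eventually_uniform] controls. *)
Lemma overlap_sub_l A A' B r : measurable A -> measurable A' -> measurable B ->
  A `<=` F -> A' `<=` F -> B `<=` F ->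
  Phi A B r <= Phi A' B r + Phi (A `\` A') F r.
Proof.
move=> mA mA' mB AF A'F BF; rewrite /overlap_sum -big_split/=.
apply: ler_sum => j _.
have mT (D : set R) : measurable D -> D `<=` F -> measurable (iter j T @` D).
  by move=> ? ?; apply: (measurable_image_iter kmlC XT) => //;
    exact: subset_trans FX.
have m1 : measurable (A `&` iter j T @` B) by apply: measurableI => //;
  exact: mT.
have m2 : measurable (A' `&` iter j T @` B) by apply: measurableI => //;
  exact: mT.
have m3 : measurable ((A `\` A') `&` iter j T @` F).
  by apply: measurableI; [exact: measurableD|exact: mT].
have f2 := mu_fin_num kmlC m2 (subset_trans (@subIsetl _ _ _) A'F).
have DF : A `\` A' `<=` F by move=> x [/AF].
have f3 := mu_fin_num kmlC m3 (subset_trans (@subIsetl _ _ _) DF).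
rewrite -fineD//; apply: fine_le; rewrite ?fin_numD ?f2 ?f3//.
  exact: (mu_fin_num kmlC m1 (subset_trans (@subIsetl _ _ _) AF)).
apply: le_trans (@measureU2 _ _ _ mu _ _ m2 m3); apply: le_measure;
  rewrite ?inE//.
  exact: measurableU.
move=> x [Ax [y By yx]]; case: (pselect (A' x)) => A'x; [left|right].
  by split=> //; exists y.
by split=> //; exists y => //; exact: BF.
Qed.

Lemma overlap_sub_r A B B' r : measurable A -> measurable B -> measurable B' ->
  A `<=` F -> B `<=` F -> B' `<=` F ->
  Phi A B r <= Phi A B' r + Phi F (B `\` B') r.
Proof.
move=> mA mB mB' AF BF B'F; rewrite /overlap_sum -big_split/=.
apply: ler_sum => j _.
have mT (D : set R) : measurable D -> D `<=` F -> measurable (iter j T @` D).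
  by move=> ? ?; apply: (measurable_image_iter kmlC XT) => //;
    exact: subset_trans FX.
have m1 : measurable (A `&` iter j T @` B) by apply: measurableI => //;
  exact: mT.
have m2 : measurable (A `&` iter j T @` B') by apply: measurableI => //;
  exact: mT.
have m3 : measurable (F `&` iter j T @` (B `\` B')).
  by apply: measurableI => //; apply: mT; [exact: measurableD|move=> x [/BF]].
have f2 := mu_fin_num kmlC m2 (subset_trans (@subIsetl _ _ _) AF).
have f3 := mu_fin_num kmlC m3 (@subIsetl _ _ _).
rewrite -fineD//; apply: fine_le; rewrite ?fin_numD ?f2 ?f3//.
  exact: (mu_fin_num kmlC m1 (subset_trans (@subIsetl _ _ _) AF)).
apply: le_trans (@measureU2 _ _ _ mu _ _ m2 m3); apply: le_measure;
  rewrite ?inE//.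
  exact: measurableU.
move=> x [Ax [y By yx]]; case: (pselect (B' y)) => B'y; [left|right].
  by split=> //; exists y.
by split; [exact: AF|exists y].
Qed.

Lemma overlap_le_r A B r : measurable A -> measurable B -> A `<=` F -> B `<=` F
  ->
  Phi A B r <= Phi A F r.
Proof.
move=> mA mB AF BF; have := overlap_sub_r r mA mB mF AF BF (@subset_refl _ F).
move/le_trans; apply; rewrite (_ : B `\` F = set0); last first.
  by rewrite -subset0 => x [/BF].
rewrite [X in _ + X](_ : _ = 0) ?addr0//; apply: big1 => j _.
by rewrite image_set0 setI0 measure0.
Qed.

Lemma overlap_le_l A B r : measurable A -> measurable B -> A `<=` F -> B `<=` F
  ->
  Phi A B r <= Phi F B r.
Proof.
move=> mA mB AF BF; have := overlap_sub_l r mA mF mB AF (@subset_refl _ F) BF.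
move/le_trans; apply; rewrite (_ : A `\` F = set0); last first.
  by rewrite -subset0 => x [/AF].
rewrite [X in _ + X](_ : _ = 0) ?addr0//; apply: big1 => j _.
by rewrite set0I measure0.
Qed.

Lemma len_sub A A' : measurable A -> measurable A' -> A `<=` F -> A' `<=` F ->
  len A <= len A' + len (A `\` A').
Proof.
move=> mA mA' AF A'F.
have mD : measurable (A `\` A') by exact: measurableD.
have DF : A `\` A' `<=` F by move=> x [/AF].
have f2 := mu_fin_num kmlC mA' A'F; have f3 := mu_fin_num kmlC mD DF.
rewrite -fineD//; apply: fine_le; rewrite ?fin_numD ?f2 ?f3//.
  exact: (mu_fin_num kmlC).
apply: le_trans (@measureU2 _ _ _ mu _ _ mA' mD); apply: le_measure;
  rewrite ?inE//.
  exact: measurableU.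
by move=> x Ax; case: (pselect (A' x)); [left|right].
Qed.

End limits.

(** * Passage to arbitrary measurable sets *)

Section approximation.
Context {R : realType}.
Variables (k l m : nat -> nat) (C : nat -> column (R := R)).
Hypothesis kmlC : column_sequence k l m C.
Hypothesis small_width : forall e : R, 0 < e ->
  exists n0, forall n, (n0 <= n)%N -> width (C n) < e.
Notation mu := (@lebesgue_measure R).
Notation len A := (fine (mu A)).
Notation column_set n A := (column_function C n (\1_A : R -> R)).
Let F := support (C 0).
Let mF : measurable F. Proof. exact: measurable_support0. Qed.

Lemma levelwise_mem n A i x y : column_set n A -> (i < height (C n))%N ->
  level (C n) i x -> level (C n) i y -> A x -> A y.
Proof.
move=> cA ih xi yi Ax; have := values_level cA ih xi.
rewrite -(values_level cA ih yi) !indicE mem_set// => /esym/eqP.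
by case: (boolP (y \in A)); [rewrite inE|rewrite eq_sym oner_eq0].
Qed.

Lemma column_setP n A : A `<=` support (C n) ->
  (forall i x y, (i < height (C n))%N -> level (C n) i x -> level (C n) i y ->
    A x -> A y) ->
  column_set n A.
Proof.
move=> AC AE; split; last by move=> x Cx; rewrite indicE memNset// => /AC.
apply/levelwise_levelP => i x ih xi; rewrite !indicE;
  congr ((nat_of_bool _)%:R).
have yi : level (C n) i (left_end (C n) i).
  by rewrite /level/= lexx ltrDl (width_gt0 kmlC).
by apply/idP/idP; rewrite !inE; [exact: AE xi yi|exact: AE yi xi].
Qed.

Definition inner_levels n (U : set R) : set R :=
  \bigcup_(i in [set i | (i < height (C n))%N /\ level (C n) i `<=` U]) level
    (C n) i.

Lemma inner_levels_sub n U : inner_levels n U `<=` U.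
Proof. by move=> x [i [_ iU] /iU]. Qed.

Lemma measurable_inner_levels n U : measurable (inner_levels n U).
Proof. by apply: bigcup_measurable => i _; exact: measurable_level. Qed.

Lemma column_set_inner_levels n U : column_set n (inner_levels n U).
Proof.
apply: column_setP => [x [i [ih _] xi]|i x y ih xi yi [j [jh jU] xj]];
  first by exists i.
by exists j; rewrite // (level_inj kmlC jh ih xj xi).
Qed.

Lemma inner_levelsS n U : inner_levels n U `<=` inner_levels n.+1 U.
Proof.
move=> x [i [ih iU] xi].
have Cx : support (C n) x by exists i.
have [j /= jh xj] := subset_support kmlC (leqnSn n) Cx.
exists j => //=; split=> // y yj; apply: (@inner_levels_sub n).
apply: (levelwise_mem _ jh xj yj); last by exists i.
exact: (column_functionS kmlC (column_set_inner_levels _ _)).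
Qed.

(** A level through x of width less than e stays in the ball of radius e around x, and it stays in F
    because F is a union of levels of every column. *)
Lemma bigcup_inner_levels U : open U ->
  \bigcup_n inner_levels n (U `&` F) = U `&` F.
Proof.
move=> oU; apply/seteqP; split=> [x [n _ /inner_levels_sub]//|x [Ux Fx]].
have /nbhs_ballP[e /= e0 eU] := open_nbhs_nbhs (conj oU Ux).
have [n /(_ _ (leqnn n)) we] := small_width e0.
have [i /= ih xi] := subset_support kmlC (leq0n n) Fx.
exists n => //; exists i => //=; split=> // y yi; split.
  apply: eU; rewrite /ball/= ltr_distl; move: xi yi; rewrite /level/=; lra.
apply: (levelwise_mem _ ih xi yi Fx);
  exact: (column_function_le kmlC (leq0n n) (column_set_support0 kmlC)).
Qed.

(** Outer regularity gives an open U around A, and the levels contained in U and F exhaust their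
    intersection. The excess A' \ A lies in U \ A, the defect A \ A' in what is not yet
    exhausted. *)
Lemma approximation A (e : R) : measurable A -> A `<=` F -> 0 < e ->
  exists n A', [/\ column_set n A', measurable A', A' `<=` F,
    len (A `\` A') <= e & len (A' `\` A) <= e].
Proof.
move=> mA AF e0.
have Aoo : (mu A < +oo)%E by rewrite -ge0_fin_numE// (mu_fin_num kmlC).
have [U [oU AU UA]] := lebesgue_regularity_outer mA Aoo e0.
have mU : measurable U by exact: open_measurable.
have mUF : measurable (U `&` F) by exact: measurableI.
pose V n := inner_levels n (U `&` F).
have mV n : measurable (V n) by exact: measurable_inner_levels.
have VF n : V n `<=` F by move=> x /inner_levels_sub[].
have UFF : U `&` F `<=` F by move=> x [].
have cV : mu (V n) @[n --> \oo] --> mu (U `&` F).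
  rewrite -(bigcup_inner_levels oU); apply: nondecreasing_cvg_mu => //.
    by rewrite bigcup_inner_levels.
  apply/nondecreasing_seqP => n; apply/subsetPset; exact: inner_levelsS.
have UFfin := mu_fin_num kmlC mUF UFF.
have cV' : len (V n) @[n --> \oo] --> len (U `&` F).
  by apply: fine_cvg; rewrite fineK.
have [n _ /(_ n (leqnn n)) /= Vn] := (cvgrPdist_lt _ _).1 cV' _ e0.
exists n, (V n); split => //; first exact: column_set_inner_levels.
- apply: (@le_trans _ _ (len ((U `&` F) `\` V n))).
    apply: (len_le kmlC);
      [exact: measurableD|exact: measurableD| |by move=> x [/UFF]].
    by move=> x [Ax Vx]; split=> //; split; [exact: AU|exact: AF].
  rewrite measureD; [|exact: mUF|exact: mV|by rewrite -ge0_fin_numE].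
  have -> : (U `&` F) `&` V n = V n by apply/setIidr => x /inner_levels_sub.
  rewrite fineB//; last exact: (mu_fin_num kmlC).
  by apply: ltW; apply: le_lt_trans Vn; exact: ler_norm.
- rewrite -[leRHS]/(fine e%:E); apply: fine_le => //.
    apply: (mu_fin_num kmlC);
      [exact: (measurableD (mV n) mA)|by move=> x [/VF]].
  apply: le_trans (ltW UA); apply: le_measure; rewrite ?inE//.
  - exact: (measurableD (mV n) mA).
  - exact: (measurableD mU mA).
  by move=> x [/inner_levels_sub[]].
Qed.

End approximation.

(** When A is approximated by A', x, x', y, z are the overlap sums of (A, B), (A', B), (F, B), (F,
    F); a, a' are mu(A), mu(A'); b, b' measure the two differences, and p, q are their overlaps with
    F. Approximation costs 17 d z, K and the change from a' to a cost d z each: 19 d z in all,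
    within 37 d z. *)
Lemma deviation_le (R : realFieldType) (d K x x' y z p q a a' b b' : R) :
  0 < d -> p <= (16 * b + d) * z -> q <= (16 * b' + d) * z ->
  x <= x' + p -> x' <= x + q -> a <= a' + b -> a' <= a + b' ->
  `|x' - a' * y| <= K -> 0 <= y <= z -> b <= d -> b' <= d -> K <= z * d ->
  `|x - a * y| <= 37 * d * z.
Proof.
rewrite !ler_norml => d0 pz qz xp x'q ab a'b' dev /andP[y0 yz] bd b'd Kd.
have z0 : 0 <= z by exact: le_trans yz.
have h1 : (16 * b + d) * z <= 17 * d * z by rewrite ler_wpM2r//; lra.
have h2 : (16 * b' + d) * z <= 17 * d * z by rewrite ler_wpM2r//; lra.
have dyz : d * y <= d * z by rewrite ler_wpM2l// ltW.
have h3 : (a - a') * y <= d * y by rewrite ler_wpM2r//; lra.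
have h4 : (a' - a) * y <= d * y by rewrite ler_wpM2r//; lra.
by lra.
Qed.

(** * Weak rational ergodicity on the initial level *)

Section weak_rational_ergodicity.
Context {R : realType}.
Variables (k l m : nat -> nat) (C : nat -> column (R := R)).
Hypothesis kmlC : column_sequence k l m C.
Variables (X : set R) (T : R -> R).
Hypothesis XT : defined_by_columns C X T.
Variable L : nat -> nat.
Hypothesis kE : forall n, k n = n.+1.
Hypothesis lE : forall n, l n = (L n * height (C n))%N.
Hypothesis L_cvg0 : forall e : R, 0 < e ->
  exists n0, forall n, (n0 <= n)%N -> (L n).+2%:R / n.+1%:R <= e.
Notation mu := (@lebesgue_measure R).
Notation len A := (fine (mu A)).
Notation Phi := (overlap_sum mu T).
Let F := support (C 0).
Let mF : measurable F. Proof. exact: measurable_support0. Qed.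

Lemma eventually_overlap_l A (e : R) : 0 < e -> measurable A -> A `<=` F ->
  exists r0, forall r, (r0 <= r)%N -> forall B, measurable B -> B `<=` F ->
    `|Phi A B r - len A * Phi F B r| <= e * Phi F F r.
Proof.
move=> e0 mA AF; pose d := e / 37.
have d0 : 0 < d by rewrite divr_gt0.
have [n [A' [cA' mA' A'F A1 A2]]] := approximation kmlC (width_small kmlC kE)
  mA AF d0.
have [K HK] := overlap_rows_deviation kmlC XT cA' mA' A'F.
have [r1 Hr1] := eventually_uniform kmlC XT kE lE L_cvg0 d0.
(* Once a_r >= K / d, the bounded deviation K is at most d a_r. *)
have [r2 Hr2] := eventually_return_ge kmlC XT kE lE (K / d).
exists (maxn r1 r2) => r; rewrite geq_max => /andP[/Hr1 Hu /Hr2 Ha] B mB BF.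
have mD1 : measurable (A `\` A') by exact: measurableD.
have mD2 : measurable (A' `\` A) by exact: measurableD.
have DF1 : A `\` A' `<=` F by move=> x [/AF].
have DF2 : A' `\` A `<=` F by move=> x [/A'F].
have [_ u1] := Hu _ mD1 DF1; have [_ u2] := Hu _ mD2 DF2.
have s1 := overlap_sub_l kmlC XT r mA mA' mB AF A'F BF.
have s2 := overlap_sub_l kmlC XT r mA' mA mB A'F AF BF.
have l1 := len_sub kmlC mA mA' AF A'F.
have l2 := len_sub kmlC mA' mA A'F AF.
have dev := HK B r mB BF.
have FB : Phi F B r <= Phi F F r.
  by apply: (overlap_le_r kmlC XT) => //; exact: subset_refl.
have FB0 : 0 <= Phi F B r by apply: sumr_ge0 => j _; exact: len_ge0.
rewrite (_ : e = 37 * d); last by rewrite /d; field.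
apply: (deviation_le d0 u1 u2 s1 s2 l1 l2 dev) => //; first by rewrite FB0.
by rewrite -ler_pdivrMr.
Qed.

Lemma eventually_overlap_r B (e : R) : 0 < e -> measurable B -> B `<=` F ->
  exists r0, forall r, (r0 <= r)%N -> forall A, measurable A -> A `<=` F ->
    `|Phi A B r - len B * Phi A F r| <= e * Phi F F r.
Proof.
move=> e0 mB BF; pose d := e / 37.
have d0 : 0 < d by rewrite divr_gt0.
have [n [B' [cB' mB' B'F A1 A2]]] := approximation kmlC (width_small kmlC kE)
  mB BF d0.
have [K HK] := overlap_cols_deviation kmlC XT cB' mB' B'F.
have [r1 Hr1] := eventually_uniform kmlC XT kE lE L_cvg0 d0.
have [r2 Hr2] := eventually_return_ge kmlC XT kE lE (K / d).
exists (maxn r1 r2) => r; rewrite geq_max => /andP[/Hr1 Hu /Hr2 Ha] A mA AF.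
have mD1 : measurable (B `\` B') by exact: measurableD.
have mD2 : measurable (B' `\` B) by exact: measurableD.
have DF1 : B `\` B' `<=` F by move=> x [/BF].
have DF2 : B' `\` B `<=` F by move=> x [/B'F].
have [u1 _] := Hu _ mD1 DF1; have [u2 _] := Hu _ mD2 DF2.
have s1 := overlap_sub_r kmlC XT r mA mB mB' AF BF B'F.
have s2 := overlap_sub_r kmlC XT r mA mB' mB AF B'F BF.
have l1 := len_sub kmlC mB mB' BF B'F.
have l2 := len_sub kmlC mB' mB B'F BF.
have dev := HK A r mA AF.
have FB : Phi A F r <= Phi F F r.
  by apply: (overlap_le_l kmlC XT) => //; exact: subset_refl.
have FB0 : 0 <= Phi A F r by apply: sumr_ge0 => j _; exact: len_ge0.
rewrite (_ : e = 37 * d); last by rewrite /d; field.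
apply: (deviation_le d0 u1 u2 s1 s2 l1 l2 dev) => //; first by rewrite FB0.
by rewrite -ler_pdivrMr.
Qed.

Lemma eventually_overlap A B (e : R) : 0 < e -> measurable A -> measurable B ->
  A `<=` F -> B `<=` F -> exists r0, forall r, (r0 <= r)%N ->
    `|Phi A B r - len A * len B * Phi F F r| <= e * Phi F F r.
Proof.
move=> e0 mA mB AF BF; have e2 : 0 < e / 2 by rewrite divr_gt0.
have [r1 H1] := eventually_overlap_l e2 mA AF.
have [r2 H2] := eventually_overlap_r e2 mB BF.
exists (maxn r1 r2) => r; rewrite geq_max => /andP[/H1 + /H2 +].
move=> /(_ B mB BF) h1 /(_ F mF (@subset_refl _ F)) h2.
(* A is replaced first, uniformly in B, and then B in the overlap with F; the second error is
   multiplied by mu(A) <= 1. *)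
have -> : Phi A B r - len A * len B * Phi F F r =
  (Phi A B r - len A * Phi F B r) + len A * (Phi F B r - len B * Phi F F r) by
    ring.
apply: (le_trans (ler_normD _ _)); rewrite [e in leRHS]splitr mulrDl lerD//.
rewrite normrM (ger0_norm (len_ge0 _)); apply: le_trans h2.
by rewrite ler_piMl// (len_le1 kmlC).
Qed.

Lemma overlap_cvg A B : measurable A -> measurable B -> A `<=` F -> B `<=` F ->
  (return_sequence mu T F n)^-1 * Phi A B n @[n --> \oo] --> len A * len B.
Proof.
move=> mA mB AF BF; apply/cvgrPdist_le => e e0.
have [r1 H1] := eventually_overlap e0 mA mB AF BF.
have [r2 H2] := eventually_return_ge kmlC XT kE lE 1.
exists (maxn r1 r2) => // r; rewrite /mkset geq_max => /andP[/H1 h1 /H2 h2].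
have P0 : 0 < Phi F F r by exact: lt_le_trans h2.
have -> : return_sequence mu T F r = Phi F F r.
  have lenF : len F = 1 by rewrite (mu_support0 kmlC).
  by transitivity (Phi F F r / len F ^+ 2); rewrite // lenF expr1n divr1.
have P0' := lt0r_neq0 P0.
rewrite distrC (_ : _ - _ = (Phi A B r - len A * len B * Phi F F r) / Phi F F
  r).
  by rewrite normrM normfV (gtr0_norm P0) ler_pdivrMr.
by rewrite mulrBl mulfK// mulrC.
Qed.

End weak_rational_ergodicity.

(** * Conservativity, ergodicity, infinite measure *)

Section conservative_ergodic.
Context {R : realType}.
Variables (k l m : nat -> nat) (C : nat -> column (R := R)).
Hypothesis kmlC : column_sequence k l m C.
Variables (X : set R) (T : R -> R).
Hypothesis XT : defined_by_columns C X T.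
Variable L : nat -> nat.
Hypothesis kE : forall n, k n = n.+1.
Hypothesis lE : forall n, l n = (L n * height (C n))%N.
Hypothesis L_cvg0 : forall e : R, 0 < e ->
  exists n0, forall n, (n0 <= n)%N -> (L n).+2%:R / n.+1%:R <= e.
Notation mu := (@lebesgue_measure R).
Notation len A := (fine (mu A)).
Notation Phi := (overlap_sum mu T).
Let F := support (C 0).
Let mF : measurable F. Proof. exact: measurable_support0. Qed.
Let FX : F `<=` X := support0_subX XT.

Lemma mu_eq0_sub (A B : set R) : measurable A -> measurable B -> A `<=` B ->
  mu B = 0%E -> mu A = 0%E.
Proof.
by move=> mA mB AB B0; apply/eqP; rewrite -measure_le0 -B0; apply: le_measure;
  rewrite ?inE.
Qed.

Lemma mu_eq0U (A B : set R) : measurable A -> measurable B ->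
  mu A = 0%E -> mu B = 0%E -> mu (A `|` B) = 0%E.
Proof.
move=> mA mB A0 B0; apply/eqP; rewrite -measure_le0.
apply: (le_trans (@measureU2 _ _ _ mu _ _ mA mB)).
by rewrite -[leLHS]/(mu A + mu B)%E A0 B0 adde0.
Qed.

Lemma len_eq0 B : measurable B -> B `<=` F -> len B = 0 -> mu B = 0%E.
Proof. by move=> mB BF B0; rewrite -(fineK (mu_fin_num kmlC mB BF)) B0. Qed.

Lemma mu_eq0_levels A : measurable A -> A `<=` X ->
  (forall n i, (i < height (C n))%N -> mu (A `&` level (C n) i) = 0%E) ->
  mu A = 0%E.
Proof.
move=> mA AX A0; apply: (@measure_negligible _ _ _ mu) => //.
have -> : A = \bigcup_n \bigcup_i (if (i < height (C n))%N then A `&` level (C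
  n) i else set0).
  apply/seteqP; split=> [x Ax|x [n _ [i _]]]; last by case: ifP => // _ [].
  have := AX _ Ax; rewrite XT.1 => -[n _ [i /= ih xi]].
  by exists n => //; exists i => //; rewrite ih.
apply: negligible_bigcup => n; apply: negligible_bigcup => i.
case: ifP => ih; last exact: negligible_set0.
apply/negligibleP; last exact: A0.
by apply: measurableI => //; exact: measurable_level.
Qed.

Lemma base_level_sub n : level (C n) 0 `<=` F.
Proof.
move=> x x0; apply: (levelwise_mem _ (height_gt0 kmlC n) (base_level kmlC n)
  x0).
  exact: (column_set_support0_le kmlC).
by exists 0%N => /=; [exact: (height_gt0 kmlC 0)|exact: (base_level kmlC 0)].
Qed.

(* The sums are also asymptotic to mu(A) mu(B) times an unbounded sequence. *)
Lemma product_eq0 A B K : measurable A -> measurable B -> A `<=` F -> B `<=` F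
  ->
  (forall r, Phi A B r <= K) -> len A * len B = 0.
Proof.
move=> mA mB AF BF PK; apply/eqP; rewrite eq_le mulr_ge0 ?len_ge0// andbT.
apply/ler_addgt0Pr => e e0; rewrite add0r.
have e2 : 0 < e / 2 by rewrite divr_gt0.
have [r1 H1] := eventually_overlap kmlC XT kE lE L_cvg0 e2 mA mB AF BF.
(* With P = a_r this yields (mu(A) mu(B) - e / 2) P <= K <= (e / 2) P; the 1 keeps P positive. *)
have [r2 H2] := eventually_return_ge kmlC XT kE lE (Num.max 1 (K / (e / 2))).
have := H1 _ (leq_maxl r1 r2); have := H2 _ (leq_maxr r1 r2).
have := PK (maxn r1 r2); rewrite ge_max ler_pdivrMr// ler_norml -/F.
set P := Phi F F _; move: (Phi A B _) => p pK /andP[P1 KP] /andP[le _].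
have P0 : 0 < P by exact: lt_le_trans P1.
rewrite -(ler_pM2r P0); lra.
Qed.

(** The part of a wandering set in level i is pulled back by T^i into level 0, hence into F. The
    resulting V is wandering too, so its overlap sums contain only the term j = 0. *)
Lemma conservative_T : conservative mu X T.
Proof.
move=> W mW WX wW; apply: mu_eq0_levels => // n i ih.
pose V := level (C n) 0 `&` (X `&` iter i T @^-1` W).
have mV : measurable V.
  by apply: measurableI;
    [exact: measurable_level|exact: (measurable_preimage_iter kmlC XT)].
have VF : V `<=` F by move=> x [/base_level_sub].
have VX := subset_trans VF FX.
have WV : W `&` level (C n) i = iter i T @` V.
  apply/seteqP; split=> [x [Wx xi]|_ [x [x0 [Xx Wx]] <-]].
    pose y := x - (left_end (C n) i - left_end (C n) 0).
    have y0 : level (C n) 0 y by move: xi; rewrite /level/= /y; lra.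
    have Ty : iter i T y = x.
      by have [] := @iter_level _ _ _ _ XT n 0 i y ih y0;
        rewrite add0n => -> _; rewrite /y subrK.
    exists y => //; split=> //; split; last by rewrite /= Ty.
    by apply: (support_subX XT (n := n)); exists 0%N => //=;
      exact: (height_gt0 kmlC).
  by split=> //; exact: (@iter_level _ _ _ _ XT n 0 i x ih x0).2.
rewrite WV (mu_image_iter kmlC XT)//; apply: len_eq0 => //.
have PV r : Phi V V r <= 1.
  case: r => [|r]; first by rewrite /overlap_sum big_geq.
  rewrite /overlap_sum big_nat_recl//= image_id setIid big1 ?addr0 ?(len_le1
    kmlC)//.
  move=> j _; rewrite (_ : _ `&` _ = set0) ?measure0//.
  rewrite -subset0 => x [[_ [Xx Wx]] [y [_ [Xy Wy]] yx]].
  suff : 0%N = j.+1 by [].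
  (* T^i y is in W, and its image under T^(j+1) is T^i x, also in W. *)
  apply: wW => //; exists (iter i T y); split; split => //=.
  - exact: (iter_stable kmlC XT).
  - exact: (iter_stable kmlC XT).
  - by move: Wx; rewrite -yx /= -!iterS -!iterD addnC.
have /eqP := product_eq0 mV mV VF VF PV.
by rewrite mulf_eq0 orbb => /eqP.
Qed.

(** Nullity climbs each column from level 0, which lies in F: A in level i + 1 is the image of T^-1
    A in level i, and T^-1 A is in A up to a null set. *)
Lemma mu_eq0_support0 A : measurable A -> A `<=` X ->
  mu ((X `&` T @^-1` A) `\` A) = 0%E -> mu (A `&` F) = 0%E -> mu A = 0%E.
Proof.
move=> mA AX inv AF0; apply: mu_eq0_levels => // n i.
have ml j : measurable (level (C n) j) by exact: measurable_level.
have mP := measurable_preimage_T kmlC XT mA.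
elim: i => [_|i IH ih].
  apply: (mu_eq0_sub _ _ _ AF0); [exact: measurableI|exact: measurableI|].
  by move=> x [Ax /base_level_sub].
have lX : level (C n) i `<=` X.
  by move=> x xi; apply: (support_subX XT (n := n)); exists i => //=;
    exact: ltnW.
have mI : measurable ((X `&` T @^-1` A) `&` level (C n) i) by exact:
  measurableI.
have -> : A `&` level (C n) i.+1 = T @` ((X `&` T @^-1` A) `&` level (C n) i).
  apply/seteqP; split=> [x [Ax xi]|_ [x [[Xx Ax] xi] <-]].
    pose y := x - (left_end (C n) i.+1 - left_end (C n) i).
    have yi : level (C n) i y by move: xi; rewrite /level/= /y; lra.
    have Ty : T y = x by rewrite (T_level XT ih yi).1 /y subrK.
    by exists y => //; split=> //; split; [exact: lX|rewrite /= Ty].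
  by split=> //; exact: (T_level XT ih xi).2.
rewrite (mu_image_T kmlC XT mI); last by move=> x [_ /lX].
have mN : measurable ((X `&` T @^-1` A) `\` A) by exact: measurableD.
have mJ : measurable (A `&` level (C n) i) by exact: measurableI.
apply: (mu_eq0_sub mI (measurableU _ _ mN mJ));
  last by rewrite mu_eq0U// IH// ltnW.
by move=> x [[Xx TAx] xi]; case: (pselect (A x)) => Ax; [right|left].
Qed.

Lemma ergodic_T : ergodic mu X T.
Proof.
move=> A mA AX inv1 inv2.
pose N := (X `&` T @^-1` A) `\` A.
have mN : measurable N by apply: measurableD => //;
  exact: (measurable_preimage_T kmlC XT).
have NX : N `<=` X by move=> x [[]].
pose B := F `\` A.
have mB : measurable B by exact: measurableD.
have BF : B `<=` F by move=> x [].
have BX := subset_trans BF FX.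
have mAB j : measurable (A `&` iter j T @` B).
  by apply: measurableI => //; exact: (measurable_image_iter kmlC XT).
(* A point of A in T^(j+1) B is T y with y in T^j B: either y is in A, which is null by induction,
   or y is in the null set N. *)
have AB0 j : mu (A `&` iter j T @` B) = 0%E.
  elim: j => [|j IH].
    rewrite image_id (_ : _ `&` _ = set0) ?measure0//.
    by rewrite -subset0 => x [Ax [_ /(_ Ax)]].
  have ABX : A `&` iter j T @` B `<=` X by move=> x [/AX].
  have mTAB := measurable_image_T kmlC XT (mAB j) ABX.
  have mTN := measurable_image_T kmlC XT mN NX.
  apply: (mu_eq0_sub (mAB j.+1) (measurableU _ _ mTAB mTN)).
    rewrite image_iterS => x [Ax [y [b Bb by_] yx]].
    case: (pselect (A y)) => Ay; [left|right]; exists y => //.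
      by split=> //; exists b.
    split=> //; split; last by rewrite /= yx.
    by rewrite -by_; apply: (iter_stable kmlC XT); exact: BX.
  apply: mu_eq0U => //; first by rewrite (mu_image_T kmlC XT (mAB j) ABX).
  by rewrite (mu_image_T kmlC XT mN NX).
have mA1 : measurable (A `&` F) by exact: measurableI.
have A1F : A `&` F `<=` F by move=> x [].
have /eqP : len (A `&` F) * len B = 0.
  apply: (@product_eq0 _ _ 0) => // r; rewrite /overlap_sum big1// => j _.
  suff e : mu ((A `&` F) `&` iter j T @` B) = 0%E by exact: (congr1 (@fine R)
    e).
  apply: (mu_eq0_sub _ (mAB j)) => //.
    by apply: measurableI => //; exact: (measurable_image_iter kmlC XT).
  by move=> x [[]].
rewrite mulf_eq0 => /orP[/eqP/(len_eq0 mA1 A1F)|/eqP/(len_eq0 mB BF)] E0.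
  by left; exact: mu_eq0_support0.
have mX := measurable_X XT.
have mXA : measurable (X `\` A) by exact: measurableD.
(* For the complement the other invariance hypothesis is used: the points outside X \ A that T sends
   into X \ A form a subset of A \ T^-1 A. *)
right; apply: mu_eq0_support0 => //.
- apply: (mu_eq0_sub _ _ _ inv1).
  + by apply: measurableD => //; exact: (measurable_preimage_T kmlC XT).
  + rewrite (_ : A `\` _ = A `\` (X `&` T @^-1` A)).
      by apply: measurableD => //; exact: (measurable_preimage_T kmlC XT).
    apply/seteqP; split=> x [Ax nTA]; split=> //; first by case.
    by move=> TA; apply: nTA; split=> //; exact: AX.
  + move=> x [[Xx [_ nTA]] nXA]; split=> //.
    by apply/not_notP => nA; apply: nXA.
- apply: (mu_eq0_sub _ mB _ E0); first exact: measurableI.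
  by move=> x [[Xx nA] Fx].
Qed.

Lemma mu_X : mu X = +oo%E.
Proof.
apply/eqP; rewrite -leye_eq leNgt; apply/negP => Xoo.
have mS n : measurable (support (C n)) by exact: measurable_support.
have Soo n : (mu (support (C n)) < +oo)%E.
  apply: le_lt_trans Xoo; apply: le_measure; rewrite ?inE.
  - exact: mS.
  - exact: measurable_X XT.
  - exact: (support_subX XT).
have lenS n : len (support (C n)) = (height (C n))%:R * width (C n).
  rewrite (@fine_measure_partition _ _ _ mu _ (fun i => level (C n) i) (height
    (C n)))//.
  - rewrite (eq_big_nat _ _ (F2 := fun=> width (C n))) ?sumr_const_nat ?subn0
      ?mulr_natl//.
    move=> i /andP[_ ih]; transitivity (len (level (C n) i)).
      by congr (fine (mu _)); apply/setIidr => x xi; exists i.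
    by rewrite (mu_level kmlC).
  - exact: mS.
  - exact: Soo.
  - by move=> i _; exact: measurable_level.
  - exact: (disjoint_levels_seq kmlC).
(* The final spacers at least double the measure: the height grows by a factor of at least 2 k m
   while the width is divided by k m. *)
have big n : n.+1%:R <= (height (C n))%:R * width (C n).
  elim: n => [|n IH]; first by rewrite kmlC.1.1 kmlC.1.2 mulr1.
  have [k0 m0 _] := kmlC.2 n; have w0 := width_gt0 kmlC n.
  rewrite (width_succ kmlC) mulrA ler_pdivlMr ?ltr0n ?muln_gt0 ?k0//.
  have le : ((2 * (k n * m n)) * height (C n) <= height (C n.+1))%N.
    rewrite (height_succ kmlC) -mulnA leq_mul2l/=.
    by rewrite -[X in (X * _ * _ <= _)%N](prednK k0); nia.
  have : ((2 * (k n * m n)) * height (C n))%:R * width (C n) <= (height (C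
    n.+1))%:R * width (C n).
    by rewrite ler_wpM2r ?ler_nat// ltW.
  apply: le_trans; rewrite !natrM -!mulrA [leRHS]mulrCA.
  have km0 : 0 < (k n)%:R * (m n)%:R :> R by rewrite mulr_gt0// ltr0n.
  have : n.+2%:R <= 2 * n.+1%:R :> R by rewrite -natrM ler_nat; lia.
  nra.
pose M := len X; pose n := (Num.truncn M).
have : len (support (C n)) <= M.
  apply: fine_le; [by rewrite ge0_fin_numE|by rewrite ge0_fin_numE|].
  apply: le_measure; rewrite ?inE.
  - exact: mS.
  - exact: measurable_X XT.
  - exact: (support_subX XT).
rewrite lenS => /(le_trans (big n)); rewrite leNgt => /negP; apply.
exact: truncnS_gt.
Qed.

End conservative_ergodic.

(** * Growth of the spacers and conclusion *)

Lemma powR_over_linear (R : realType) (alpha e : R) : 0 < alpha < 1 -> 0 < e ->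
  exists n0, forall n, (n0 <= n)%N ->
    (Num.truncn (n%:R `^ alpha)).+2%:R / n.+1%:R <= e.
Proof.
move=> /andP[a0 a1] e0; pose b := 1 - alpha.
have b0 : 0 < b by rewrite subr_gt0.
pose M := 2 / e; have M0 : 0 < M by rewrite divr_gt0.
(* The first bound gives n^b >= M = 2 / e, so n^alpha <= e n / 2; the second gives 2 <= e n / 2,
   which absorbs the added 2. *)
exists (maxn (Num.truncn (M `^ b^-1)).+1 (Num.truncn (4 / e)).+1) => n.
rewrite geq_max => /andP[n1 n2].
have nM : M `^ b^-1 <= n%:R.
  by apply: (le_trans (ltW (truncnS_gt _))); rewrite ler_nat.
have ne : 4 / e <= n%:R.
  by apply: (le_trans (ltW (truncnS_gt _))); rewrite ler_nat.
have n_gt0 : 0 < n%:R :> R by rewrite ltr0n (leq_trans _ n1).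
have Mb : M <= n%:R `^ b.
  have -> : M = (M `^ b^-1) `^ b by rewrite -powRrM mulVf ?lt0r_neq0// powRr1//
    ltW.
  by apply: ge0_ler_powR; rewrite ?nnegrE ?powR_ge0// ltW.
have nab : n%:R `^ alpha * n%:R `^ b = n%:R.
  rewrite -powRD; first by rewrite /b addrC subrK powRr1// ltW.
  by rewrite (gt_eqF n_gt0)/= implybT.
have L : (Num.truncn (n%:R `^ alpha))%:R <= n%:R `^ alpha.
  by rewrite truncn_le// powR_ge0.
rewrite ler_pdivrMr ?ltr0n// -addn2 natrD -natr1.
move: ne; rewrite ler_pdivrMr// => ne.
have : M * n%:R `^ alpha <= n%:R.
  by rewrite -[leRHS]nab mulrC ler_wpM2l ?powR_ge0.
rewrite /M mulrAC ler_pdivrMr// => aM.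
move: L; move: (n%:R `^ alpha) aM => x aM; move: (_%:R) => y yx; nra.
Qed.

Theorem theorem3p1 (R : realType) (X : set R) (T : R -> R)
    (TV : class_V X T) :
  weakly_rationally_ergodic (@lebesgue_measure R) X T /\
  infinite_measure_preserving (@lebesgue_measure R) X T.
Proof.
have [alpha [a01 [k [l [m [C [kmlC XT kE lE _]]]]]]] := TV.
pose L n := Num.truncn (n%:R `^ alpha).
have L0 (e : R) : 0 < e -> exists n0, forall n, (n0 <= n)%N -> (L n).+2%:R /
  n.+1%:R <= e.
  exact: powR_over_linear.
have imp := invertible_measure_preserving_T kmlC XT (width_cvg0 kmlC kE).
split; last by split=> //; exact: (mu_X kmlC XT).
split=> //.
- exact: (conservative_T kmlC XT kE lE L0).
- exact: (ergodic_T kmlC XT kE lE L0).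
- exists (support (C 0)); split.
  + exact: measurable_support0.
  + exact: (support0_subX XT).
  + by rewrite -[X in (_ < X)%E]/(lebesgue_measure (support (C 0%N)))
      (mu_support0 kmlC).
  + rewrite -[X in (X < _)%E]/(lebesgue_measure (support (C 0%N))) (mu_support0
      kmlC).
    exact: ltry.
  + by move=> A B mA mB AF BF; exact: (overlap_cvg kmlC XT kE lE L0).
Qed.
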